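(* Let $R$ be a field, let $X$ and $Y$ be compact, Hausdorff, locally contractible topological spaces, and let $f:X\to Y$ be continuous. Let $\mathcal V$ be a finite open cover of the image $f(X)\subset Y$ whose nerve $N_{\mathcal V}$ is at most one-dimensional. Then, for each $n\in\mathbb N$, $$H^{n}(X;R)\;\cong\; H^0(N_{\mathcal V};\mathcal L^n)\oplus H^1(N_{\mathcal V};\mathcal L^{n-1}),$$ where $\mathcal L^n$ are the Leray cellular sheaves associated to $f$ and $\mathcal V$ (with $\mathcal L^{-1}=0$).
   Context: The nerve $N_{\mathcal V}$ of a cover $\mathcal V$ is the abstract simplicial complex whose $k$-dimensional simplices are collections $\sigma=(V_0,\dots,V_k)$ of (distinct) cover elements with non-empty support $V_\sigma=\bigcap_{j=0}^k V_j$; it is identified with its geometric realization, a regular CW complex. A cellular sheaf $\mathcal F$ over a finite regular CW complex $\mathcal X$ assigns to each cell $\sigma$ an $R$-module $\mathcal F(\sigma)$ and to each face relation $\sigma\le\tau$ a linear restriction map $\mathcal F_{\sigma\tau}:\mathcal F(\sigma)\to\mathcal F(\tau)$ with $\mathcal F_{\lambda\tau}\circ\mathcal F_{\sigma\lambda}=\mathcal F_{\sigma\tau}$ whenever $\sigma\le\lambda\le\tau$. Its cochain complex is $C^k(\mathcal X;\mathcal F)=\bigoplus_{\dim\sigma=k}\mathcal F(\sigma)$, with coboundary $\delta^k:C^k\to C^{k+1}$ whose component from $\mathcal F(\sigma)$ to $\mathcal F(\tau)$ is $[\sigma:\tau]\mathcal F_{\sigma\tau}$, where $[\sigma:\tau]=\pm1$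 if $\sigma$ is a codimension-one face of $\tau$ (sign according to whether chosen orientations agree or disagree) and $0$ otherwise. The sheaf cohomology is $H^k(\mathcal X;\mathcal F)=\ker\delta^k/\operatorname{im}\delta^{k-1}$. The Leray cellular sheaves $\mathcal L^n$ associated to a map $f:X\to Y$ and a cover $\mathcal V$ of $f(X)$ are the cellular sheaves over $N_{\mathcal V}$ with $\mathcal L^n(\sigma)=H^n(f^{-1}(V_\sigma);R)$, and with restriction map for each face relation $\sigma\subset\tau$ the map induced on cohomology by the inclusion $f^{-1}(V_\tau)\hookrightarrow f^{-1}(V_\sigma)$. Here $H^n(-;R)$ denotes ordinary (singular) cohomology. *)

(* Defs.v *)
From HB Require Import structures.
From mathcomp Require Import all_boot all_order all_algebra generic_quotient.
From mathcomp Require Import ring_quotient zify.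
From mathcomp Require Import all_classical all_reals all_analysis.

Set Implicit Arguments.
Unset Strict Implicit.
Unset Printing Implicit Defensive.

Import Order.TTheory GRing.Theory Num.Theory.
Import numFieldNormedType.Exports.

Local Open Scope classical_set_scope.
Local Open Scope ring_scope.
Local Open Scope quotient_scope.

Section DirectProduct.
Context {R : comNzRingType} {I : Type}.

Definition dprod (F : I -> lmodType R) : Type := forall i, F i.

Context (F : I -> lmodType R).
Implicit Types u v : dprod F.

HB.instance Definition _ := gen_eqMixin (dprod F).
HB.instance Definition _ := gen_choiceMixin (dprod F).

Definition dprod_zero : dprod F := fun=> 0.
Definition dprod_opp u : dprod F := fun i => - u i.
Definition dprod_add u v : dprod F := fun i => u i + v i.
Definition dprod_scale (a : R) u : dprod F := fun i => a *: u i.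

Lemma dprod_addA : associative dprod_add.
Proof. by move=> u v w; apply: functional_extensionality_dep => i; exact: addrA. Qed.
Lemma dprod_addC : commutative dprod_add.
Proof. by move=> u v; apply: functional_extensionality_dep => i; exact: addrC. Qed.
Lemma dprod_add0 : left_id dprod_zero dprod_add.
Proof. by move=> u; apply: functional_extensionality_dep => i; exact: add0r. Qed.
Lemma dprod_addN : left_inverse dprod_zero dprod_opp dprod_add.
Proof. by move=> u; apply: functional_extensionality_dep => i; exact: addNr. Qed.

HB.instance Definition _ := GRing.isZmodule.Build (dprod F)
  dprod_addA dprod_addC dprod_add0 dprod_addN.

Lemma dprod_scaleA a b u :
  dprod_scale a (dprod_scale b u) = dprod_scale (a * b) u.
Proof. by apply: functional_extensionality_dep => i; exact: scalerA. Qed.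
Lemma dprod_scale1 : left_id 1 dprod_scale.
Proof. by move=> u; apply: functional_extensionality_dep => i; exact: scale1r. Qed.
Lemma dprod_scaleDr : right_distributive dprod_scale +%R.
Proof. by move=> a u v; apply: functional_extensionality_dep => i; exact: scalerDr. Qed.
Lemma dprod_scaleDl u : {morph dprod_scale^~ u : a b / a + b}.
Proof. by move=> a b; apply: functional_extensionality_dep => i; exact: scalerDl. Qed.

HB.instance Definition _ := GRing.Zmodule_isLmodule.Build R (dprod F)
  dprod_scaleA dprod_scale1 dprod_scaleDr dprod_scaleDl.

End DirectProduct.

Record cochainComplex (R : comNzRingType) := CochainComplex {
  cochains :> nat -> lmodType R;
  codiff : forall k, {linear cochains k -> cochains k.+1};
  codiffK : forall k (c : cochains k), codiff k.+1 (codiff k c) = 0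
}.
Arguments codiff {R} C k : rename.

Section Cohomology.
Context {R : comNzRingType} (C : cochainComplex R) (k : nat).

Definition is_cocycle : {pred C k} := fun c => codiff C k c == 0.

Lemma is_cocycle_submod : submod_closed is_cocycle.
Proof.
split=> [|a u v]; rewrite /is_cocycle !unfold_in ?linear0//.
by move=> /eqP u0 /eqP v0; rewrite linearP u0 v0 scaler0 addr0.
Qed.
HB.instance Definition _ :=
  GRing.isSubmodClosed.Build R (C k) is_cocycle is_cocycle_submod.

Record cocycles := Cocycle {
  cocycle_val :> C k;
  cocycle_prop : cocycle_val \in is_cocycle
}.
HB.instance Definition _ := [isSub for cocycle_val].
HB.instance Definition _ := [Choice of cocycles by <:].
HB.instance Definition _ := [SubChoice_isSubLmodule of cocycles by <:].

(* In degree 0 the incoming differential is 0. *)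
Definition in_image : C k -> Prop :=
  match k return C k -> Prop with
  | 0 => fun c => c = 0
  | j.+1 => fun c => exists b : C j, c = codiff C j b
  end.

Lemma in_image0 : in_image 0.
Proof. by rewrite /in_image; case: k => //= j; exists 0; rewrite linear0. Qed.

Lemma in_imageP a u v : in_image u -> in_image v -> in_image (a *: u + v).
Proof.
rewrite /in_image; case: k u v => /= [u v -> ->|j u v [b ->] [c ->]].
  by rewrite scaler0 addr0.
by exists (a *: b + c); rewrite linearP.
Qed.

Definition is_coboundary : {pred cocycles} := fun z => `[< in_image (val z) >].

Lemma is_coboundary_submod : submod_closed is_coboundary.
Proof.
split=> [|a u v]; rewrite !unfold_in.
  by apply/asboolP; exact: in_image0.
by move=> /asboolP u0 /asboolP v0; apply/asboolP; exact: in_imageP.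
Qed.
HB.instance Definition _ :=
  GRing.isSubmodClosed.Build R cocycles is_coboundary is_coboundary_submod.

Definition cohomology : Type := Quotient.quot is_coboundary.
HB.instance Definition _ := GRing.Zmodule.on cohomology.

Definition coh_class (z : cocycles) : cohomology :=
  \pi_(Quotient.quot is_coboundary) z.

Lemma coh_classP z w : coh_class z = coh_class w <-> in_image (val z - val w).
Proof.
have -> : in_image (val z - val w) <-> z - w \in is_coboundary.
  by rewrite unfold_in; split=> /asboolP.
by rewrite Quotient.idealrBE; split=> /eqP.
Qed.

Lemma coh_class_repr (x : cohomology) : coh_class (repr (x : Quotient.quot _)) = x.
Proof. exact: reprK. Qed.

Lemma coh_classD z w : coh_class (z + w) = coh_class z + coh_class w.
Proof. exact: (raddfD \pi_(Quotient.quot is_coboundary)). Qed.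

Definition coh_scale (a : R) (x : cohomology) : cohomology :=
  coh_class (a *: repr (x : Quotient.quot _)).

Lemma coh_scaleE a z : coh_scale a (coh_class z) = coh_class (a *: z).
Proof.
apply/coh_classP; rewrite -[val _ - val _]/(val (a *: repr _ - a *: z)).
rewrite -scalerBr.
set y := repr _.
have /coh_classP yz : coh_class y = coh_class z by exact: coh_class_repr.
by have := in_imageP a yz in_image0; rewrite addr0.
Qed.

Lemma coh_scaleA a b x : coh_scale a (coh_scale b x) = coh_scale (a * b) x.
Proof. by rewrite -[x]coh_class_repr !coh_scaleE scalerA. Qed.
Lemma coh_scale1 : left_id 1 coh_scale.
Proof. by move=> x; rewrite -[x]coh_class_repr !coh_scaleE scale1r. Qed.
Lemma coh_scaleDr : right_distributive coh_scale +%R.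
Proof.
move=> a x y; rewrite -[x]coh_class_repr -[y]coh_class_repr.
by rewrite -coh_classD !coh_scaleE -coh_classD scalerDr.
Qed.
Lemma coh_scaleDl x : {morph coh_scale^~ x : a b / a + b}.
Proof.
by move=> a b; rewrite -[x]coh_class_repr !coh_scaleE -coh_classD scalerDl.
Qed.

HB.instance Definition _ := GRing.Zmodule_isLmodule.Build R cohomology
  coh_scaleA coh_scale1 coh_scaleDr coh_scaleDl.

Lemma coh_classZ a z : coh_class (a *: z) = a *: coh_class z.
Proof. by rewrite -coh_scaleE. Qed.

End Cohomology.
Arguments is_cocycle {R} C k.
Arguments is_coboundary {R} C k.

Section InducedMap.
Context {R : comNzRingType} (C D : cochainComplex R).
Variables (phi : forall k, {linear C k -> D k})
  (phiK : forall k (c : C k), phi k.+1 (codiff C k c) = codiff D k (phi k c))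
  (k : nat).

Lemma cochain_map_cocycle (z : cocycles C k) : phi k (val z) \in is_cocycle D k.
Proof.
case: z => c /=; rewrite !unfold_in /is_cocycle => /eqP c0.
by rewrite -phiK c0 linear0.
Qed.

Lemma cochain_map_image (c : C k) : in_image c -> in_image (phi k c).
Proof.
rewrite /in_image; case: k c => [c ->|j c [b ->]]; first exact: linear0.
by exists (phi j b); rewrite phiK.
Qed.

Definition coh_map (x : cohomology C k) : cohomology D k :=
  coh_class (Cocycle (cochain_map_cocycle (repr (x : Quotient.quot _)))).

Lemma coh_mapE z : coh_map (coh_class z) = coh_class (Cocycle (cochain_map_cocycle z)).
Proof.
apply/coh_classP => /=; rewrite -linearB; apply: cochain_map_image.
by apply/coh_classP; exact: coh_class_repr.
Qed.

Lemma coh_map_linear : linear coh_map.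
Proof.
move=> a x y; rewrite -[x]coh_class_repr -[y]coh_class_repr.
rewrite -coh_classZ -coh_classD !coh_mapE -coh_classZ -coh_classD.
by congr coh_class; apply: val_inj => /=; rewrite linearP.
Qed.
HB.instance Definition _ :=
  GRing.isLinear.Build R (cohomology C k) (cohomology D k) _ coh_map coh_map_linear.

End InducedMap.

Definition std_simplex (K : realType) (n : nat) : set 'rV[K]_n.+1 :=
  [set x | (forall i, 0 <= x 0 i) /\ \sum_i x 0 i = 1].
Arguments std_simplex : clear implicits.

Section FaceMaps.
Context {K : realType}.
Local Notation std_simplex := (std_simplex K).

(* The affine map sending the [j]-th vertex to the [lift i j]-th one. *)
Definition face_fun n (i : 'I_n.+2) (x : 'rV[K]_n.+1) : 'rV[K]_n.+2 :=
  \row_k oapp (x 0) 0 (unlift i k).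

Lemma face_fun_simplex n i (x : std_simplex n) : face_fun i (set_val x) \in std_simplex n.+1.
Proof.
have /set_mem[x0 x1] := svalP x; apply/mem_set; split=> [k|].
  by rewrite mxE; case: unliftP => /=.
rewrite (bigD1_ord i)//= mxE unlift_none add0r -[RHS]x1.
by apply: eq_bigr => j _; rewrite mxE liftK.
Qed.

Definition face n (i : 'I_n.+2) (x : std_simplex n) : std_simplex n.+1 :=
  exist _ (face_fun i (set_val x)) (face_fun_simplex i x).

Lemma face_fun_continuous n (i : 'I_n.+2) : continuous (face_fun (n := n) i).
Proof.
move=> x A [P xP PA].
exists (fun r j => P r (lift i j)) => [r j|y yP].
  by have := xP r (lift i j); rewrite mxE liftK [r]ord1.
apply: PA => r k; rewrite mxE [r]ord1; case: unliftP => [j ->|->] /=.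
  exact: yP.
by have := nbhs_singleton (xP 0 i); rewrite mxE unlift_none.
Qed.

Lemma face_continuous n (i : 'I_n.+2) : continuous (face (n := n) i).
Proof.
apply: continuous_comp_initial.
have -> : set_val \o face (n := n) i = face_fun i \o set_val by [].
move=> x; apply: continuous_comp; first exact: initial_continuous.
exact: face_fun_continuous.
Qed.
HB.instance Definition _ n (i : 'I_n.+2) :=
  isContinuous.Build _ _ (face (n := n) i) (@face_continuous n i).

Lemma face_face n (i : 'I_n.+3) (j i' : 'I_n.+2) (x : std_simplex n) :
  i' = unbump j i :> nat -> face i (face j x) = face (lift i j) (face i' x).
Proof.
move=> i'E; have iE : lift (lift i j) i' = i.
  by apply: val_inj; rewrite /= i'E /bump /unbump; case: ltnP => /= *; lia.
apply: val_inj; apply/rowP => k; rewrite !mxE.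
case: (unliftP i k) => [k' ->|->]; last first.
  by rewrite -[X in unlift _ X]iE liftK /= mxE unlift_none.
rewrite /= mxE; case: (unliftP j k') => [k'' ->|->] /=; last by rewrite unlift_none.
have -> : lift i (lift j k'') = lift (lift i j) (lift i' k'').
  by apply: val_inj; rewrite /= i'E bumpC.
by rewrite liftK /= mxE liftK.
Qed.

End FaceMaps.

Section SingularCochains.
Context (K : realType) (R : comNzRingType) (T : topologicalType).

Definition singular_simplex n : Type := continuousType (std_simplex K n) T.

(* Linear forms on the free module on the singular simplices, i.e. arbitrary
   functions on singular simplices. *)
Definition singular_cochains n : lmodType R := singular_simplex n -> R^o.

Definition singular_codiff n (c : singular_cochains n) : singular_cochains n.+1 :=
  fun s => \sum_(i < n.+2) (-1) ^+ i * c (s \o face i : continuousType _ _).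

Lemma singular_codiff_linear n : linear (@singular_codiff n).
Proof.
move=> a u v; apply/funext => s.
transitivity (a * singular_codiff u s + singular_codiff v s); last by [].
rewrite /singular_codiff mulr_sumr -big_split; apply: eq_bigr => i _ /=.
by rewrite mulrDr mulrCA.
Qed.
HB.instance Definition _ n := GRing.isLinear.Build R
  (singular_cochains n) (singular_cochains n.+1) _
  (@singular_codiff n) (@singular_codiff_linear n).

Lemma singular_codiffK n (c : singular_cochains n) :
  singular_codiff (singular_codiff c) = 0.
Proof.
apply/funext => s; rewrite /singular_codiff [RHS]/=.
pose F (p : 'I_n.+3 * 'I_n.+2) : R := (-1) ^+ (p.1 + p.2) *
  c ((s \o face p.1 : continuousType _ _) \o face p.2 : continuousType _ _).
transitivity (\sum_p F p).
  rewrite (eq_bigr (fun i => \sum_j F (i, j))); first by rewrite pair_bigA.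
  by move=> i _; rewrite mulr_sumr; apply: eq_bigr => j _; rewrite mulrA -exprD.
pose low (p : 'I_n.+3 * 'I_n.+2) := (p.2 < p.1)%N.
pose swap (p : 'I_n.+3 * 'I_n.+2) : 'I_n.+3 * 'I_n.+2 :=
  (lift p.1 p.2, inord (unbump p.2 p.1)).
have swap2 p : (swap p).2 = unbump p.2 p.1 :> nat.
  rewrite inordK// /unbump; have := ltn_ord p.1; have := ltn_ord p.2.
  by case: ltnP; lia.
have swapK : involutive swap.
  move=> p; have e := swap2 p; case: p e => i j /= e.
  have := ltn_ord i; have := ltn_ord j => jn ijn.
  have ub : unbump (unbump j i) (bump i j) = j :> nat.
    by rewrite /unbump /bump; do 3!(case: ltnP => /=); lia.
  congr pair; apply: val_inj => /=; last by rewrite inordK /= e ub.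
  by rewrite e /unbump /bump; do 3!(case: ltnP => /=); lia.
have lowN p : low (swap p) = ~~ low p.
  rewrite /low swap2 /= /unbump /bump.
  by have := ltn_ord p.1; have := ltn_ord p.2; do 3!(case: ltnP => /=); lia.
rewrite (bigID low)/= [X in _ + X](reindex_inj (inv_inj swapK))/=.
rewrite [X in _ + X](eq_bigl low); last by move=> p; rewrite lowN negbK.
rewrite -big_split/=; apply: big1 => p lowp.
have -> : F (swap p) = - F p; last by rewrite subrr.
rewrite /F -mulNr; congr (_ * c _).
  rewrite swap2 /swap /= /bump /unbump.
  move: lowp; rewrite /low => lowp; rewrite lowp /= leqNgt lowp add0n.
  have -> : (p.1 + p.2 = (p.2 + (p.1 - 1)).+1)%N by lia.
  by rewrite exprS mulN1r opprK.
apply/continuousEP => x /=; congr (s _).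
by apply/esym/face_face; exact: swap2.
Qed.

Definition singular_complex : cochainComplex R :=
  @CochainComplex R singular_cochains (fun n => @singular_codiff n : {linear _ -> _})
    singular_codiffK.

Definition singular_cohomology n : lmodType R := cohomology singular_complex n.

End SingularCochains.

Section SingularPullback.
Context (K : realType) (R : comNzRingType) (T U : topologicalType).
Variable g : continuousType T U.

Definition singular_comp n (c : singular_cochains K R U n) : singular_cochains K R T n :=
  fun s => c (g \o s : continuousType _ _).

Lemma singular_comp_linear n : linear (@singular_comp n).
Proof. by []. Qed.
HB.instance Definition _ n := GRing.isLinear.Build R
  (singular_cochains K R U n) (singular_cochains K R T n) _
  (@singular_comp n) (@singular_comp_linear n).

Lemma singular_compK n (c : singular_complex K R U n) :
  singular_comp (codiff (singular_complex K R U) n c) =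
  codiff (singular_complex K R T) n (singular_comp c).
Proof.
apply/funext => s; rewrite /= /singular_comp /singular_codiff.
apply: eq_bigr => i _; congr (_ * c _).
by apply/continuousEP.
Qed.

Definition singular_pullback n :
    {linear singular_cohomology K R U n -> singular_cohomology K R T n} :=
  @coh_map R (singular_complex K R U) (singular_complex K R T)
    (fun n => @singular_comp n : {linear _ -> _}) singular_compK n.

End SingularPullback.

Record simplicialComplex (m : nat) := SimplicialComplex {
  simplices : {set {set 'I_m}};
  simplices_neq0 : forall s, s \in simplices -> s != finset.set0;
  simplices_face : forall s t : {set 'I_m},
    t \in simplices -> s \subset t -> s != finset.set0 -> s \in simplices
}.

Section CellularSheaf.
Context {m : nat} (X : simplicialComplex m).

Definition simplex : Type := {s : {set 'I_m} | s \in simplices X}.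

Record cellularSheaf (R : comNzRingType) := CellularSheaf {
  stalk :> simplex -> lmodType R;
  restr : forall s t : simplex, val s \subset val t -> {linear stalk s -> stalk t};
  restr_id : forall (s : simplex) (h : val s \subset val s) x, restr h x = x;
  restr_comp : forall (s l t : simplex) (hsl : val s \subset val l)
    (hlt : val l \subset val t) (hst : val s \subset val t) x,
    restr hlt (restr hsl x) = restr hst x
}.

Definition dim_simplex (k : nat) : Type := {s : simplex | #|val s| == k.+1}.

Definition dim_le (d : nat) : Prop :=
  forall s : {set 'I_m}, s \in simplices X -> (#|s| <= d.+1)%N.

End CellularSheaf.

(* [o s] tells whether the chosen orientation of [s] is opposite to the one
   given by the order of its vertices.  When [s] is obtained from [t] by
   removing the vertex [v], the sum below is the position of [v] in [t]. *)
Definition incidence (R : comNzRingType) m (o : {set 'I_m} -> bool)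
    (s t : {set 'I_m}) : R :=
  if (s \subset t) && (#|t| == #|s|.+1) then
    (-1) ^+ (o s + o t + \sum_(v in t :\: s) #|[set i in t | (i < v)%N]%SET|)
  else 0.

Section IncidenceLemmas.
Context (R : comNzRingType) (m : nat) (o : {set 'I_m} -> bool).
Local Notation inc := (incidence R o).
Implicit Types (s t r : {set 'I_m}) (a b v : 'I_m).

Lemma incidenceU1 t v : v \notin t -> inc t (v |: t) =
  (-1) ^+ (o t + o (v |: t)%SET + #|[set i in v |: t | (i < v)%N]%SET|).
Proof.
move=> vt; rewrite /incidence finset.subsetUr cardsU1 vt eqxx/= finset.setDUl finset.setDv.
rewrite finset.setU0 (_ : ([set v] :\: t)%SET = [set v]%SET) ?big_set1//.
by apply/finset.setP => i; rewrite !inE; case: eqP => [->|]; rewrite ?vt ?andbF.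
Qed.

Lemma incidence_neq0 s t : inc s t != 0 -> exists2 v, v \notin s & t = (v |: s)%SET.
Proof.
rewrite /incidence; case: ifP => [/andP[st /eqP ts] _|]; last by rewrite eqxx.
have /eqP/cards1P[v vE] : #|t :\: s| = 1%N by rewrite cardsDS// ts subSnn.
have : v \in (t :\: s)%SET by rewrite vE inE.
rewrite inE => /andP[vs _]; exists v => //.
by rewrite -vE finset.setUC -[LHS](finset.setID t s) (finset.setIidPr st).
Qed.

Lemma incidence_diamond s a b : (a < b)%N -> a \notin s -> b \notin s ->
  inc s (a |: s) * inc (a |: s) (b |: (a |: s)) +
  inc s (b |: s) * inc (b |: s) (b |: (a |: s)) = 0.
Proof.
move=> ab as_ bs; have anb : a != b by apply: contraTneq ab => ->; rewrite ltnn.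
rewrite [X in _ + _ * inc _ X]finset.setUCA.
rewrite !incidenceU1 ?inE ?negb_or ?anb 1?eq_sym ?anb//.
rewrite -!exprD.
have -> : #|[set i in (b |: (a |: s)) | (i < b)%N]%SET| =
  #|[set i in (b |: s) | (i < b)%N]%SET|.+1.
  rewrite -[RHS]add1n -(_ : (a \notin [set i in (b |: s) | (i < b)%N]%SET) = 1%N :> nat).
    rewrite -cardsU1; apply: eq_card => i; rewrite !inE.
    by have [->|ia] := eqVneq i a; rewrite //= orbT ab.
  by rewrite !inE (negbTE anb) (negbTE as_).
have -> : #|[set i in (a |: (b |: s)) | (i < a)%N]%SET| =
  #|[set i in (a |: s) | (i < a)%N]%SET|.
  apply: eq_card => i; rewrite !inE.
  have [->|ib] := eqVneq i b; first by rewrite (ltnNge b) (ltnW ab) !andbF.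
  by rewrite orFb.
rewrite (finset.setUCA [set a]%SET).
set A := #|_|; set B := #|_|; set u := (b |: (a |: s))%SET.
rewrite -signr_odd -[X in _ + X]signr_odd !oddD /= !oddb.
move: (o s) (o u) (o (a |: s)%SET) (o (b |: s)%SET) (odd A) (odd B) => [] [] [] [] [] [];
  by rewrite /= ?expr0 ?expr1 ?addrN ?addNr.
Qed.

End IncidenceLemmas.

Section SheafCohomology.
Context {m : nat} {X : simplicialComplex m} {R : comNzRingType}.
Variables (o : {set 'I_m} -> bool) (F : cellularSheaf X R).

Definition restr0 (s t : simplex X) : {linear F s -> F t} :=
  match @idP (val s \subset val t) with
  | ReflectT h => restr F h
  | ReflectF _ => \0
  end.

(* The direct sum over the finitely many [k]-simplices, as a product. *)
Definition sheaf_cochains k : lmodType R :=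
  dprod (fun s : dim_simplex X k => F (val s)).

Definition sheaf_codiff k (c : sheaf_cochains k) : sheaf_cochains k.+1 :=
  fun t => \sum_(s : dim_simplex X k)
    incidence R o (val (val s)) (val (val t)) *: restr0 (val s) (val t) (c s).

Lemma sheaf_codiff_linear k : linear (@sheaf_codiff k).
Proof.
move=> a u v; apply: functional_extensionality_dep => t.
rewrite /sheaf_codiff.
transitivity (a *: sheaf_codiff u t + sheaf_codiff v t); last by [].
rewrite /sheaf_codiff scaler_sumr -big_split; apply: eq_bigr => i _ /=.
by rewrite linearP scalerDr !scalerA mulrC.
Qed.
HB.instance Definition _ k := GRing.isLinear.Build R
  (sheaf_cochains k) (sheaf_cochains k.+1) _
  (@sheaf_codiff k) (@sheaf_codiff_linear k).

Lemma restr0E (s t : simplex X) (h : val s \subset val t) : restr0 s t = restr F h.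
Proof.
by rewrite /restr0; case: {-}_ / idP => [h'|//]; rewrite (bool_irrelevance h' h).
Qed.

Lemma incidence_sum k (s : dim_simplex X k) (r : dim_simplex X k.+2) :
  \sum_(t : dim_simplex X k.+1) incidence R o (val (val s)) (val (val t)) *
    incidence R o (val (val t)) (val (val r)) = 0.
Proof.
case: s r => [[s sX] /= /eqP sk] [[r rX] /= rk].
have [sr|/negP sr] := boolP (s \subset r); last first.
  apply: big1 => t _; rewrite /incidence; case: ifPn => [/andP[st _]|]; rewrite ?mul0r//.
  case: ifPn => [/andP[tr _]|]; rewrite ?mulr0//.
  by case: sr; exact: fintype.subset_trans st tr.
have [a [b [ab rE as_ bs]]] : exists a b : 'I_m, [/\ (a < b)%N, r = (b |: (a |: s))%SET,
    a \notin s & b \notin s].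
  have /eqP/cards2P[a [b [anb abE]]] : #|r :\: s| = 2%N.
    by rewrite cardsDS// (eqP rk) sk; lia.
  have rE : r = ([set a; b] :|: s)%SET.
    by rewrite -abE finset.setUC -[LHS](finset.setID r s) (finset.setIidPr sr).
  have : a \in (r :\: s)%SET by rewrite abE !inE eqxx.
  have : b \in (r :\: s)%SET by rewrite abE !inE eqxx orbT.
  rewrite !inE => /andP[bs _] /andP[as_ _].
  have [ab|ba|/val_inj ab] := ltngtP a b; last by rewrite ab eqxx in anb.
  - exists a, b; split=> //; rewrite rE.
    by apply/finset.setP => i; rewrite !inE; case: (i == a); case: (i == b).
  - exists b, a; split=> //; rewrite rE.
    by apply/finset.setP => i; rewrite !inE; case: (i == a); case: (i == b).
have anb : a != b by apply: contraTneq ab => ->; rewrite ltnn.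
have mk v : v \notin s -> (v |: s)%SET \subset r ->
    exists t : dim_simplex X k.+1, val (val t) = (v |: s)%SET.
  move=> vs vr.
  have tX : (v |: s)%SET \in simplices X.
    apply: simplices_face rX vr _; apply/set0Pn; exists v; by rewrite !inE eqxx.
  pose t : simplex X := exist (fun u => u \in simplices X) _ tX.
  have tk : #|val t| == k.+2 by rewrite /= cardsU1 vs sk.
  by exists (exist (fun u : simplex X => #|val u| == k.+2) t tk).
have [|ta taE] := mk a as_; first by rewrite rE finset.subsetUr.
have [|tb tbE] := mk b bs.
  by rewrite rE finset.setUS// finset.subsetUr.
have tab : tb != ta.
  apply/eqP => tt; have : a \in (b |: s)%SET by rewrite -tbE tt taE !inE eqxx.
  by rewrite !inE (negbTE anb) (negbTE as_).
rewrite (bigD1 ta)//= (bigD1 tb)//= big1 ?addr0.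
  by rewrite taE tbE rE; exact: incidence_diamond.
move=> t /andP[tna tnb]; apply/eqP; apply: contraT => st0.
have /incidence_neq0[v vs tE] : incidence R o s (val (val t)) != 0.
  by apply: contraNneq st0 => ->; rewrite mul0r.
have /incidence_neq0[w wt] : incidence R o (val (val t)) r != 0.
  by apply: contraNneq st0 => ->; rewrite mulr0.
move=> rE'; have : v \in r by rewrite rE' tE !inE eqxx orbT.
rewrite rE !inE (negbTE vs) orbF => /orP[]/eqP vE.
- by case/eqP: tnb; apply: val_inj; apply: val_inj; rewrite tE vE tbE.
- by case/eqP: tna; apply: val_inj; apply: val_inj; rewrite tE vE taE.
Qed.

Lemma sheaf_codiffK k (c : sheaf_cochains k) :
  sheaf_codiff (sheaf_codiff c) = 0.
Proof.
apply: functional_extensionality_dep => r; rewrite /sheaf_codiff.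
transitivity (\sum_(s : dim_simplex X k) (\sum_(t : dim_simplex X k.+1)
   incidence R o (val (val s)) (val (val t)) * incidence R o (val (val t)) (val (val r)))
   *: restr0 (val s) (val r) (c s)).
  under eq_bigr do rewrite linear_sum scaler_sumr.
  rewrite exchange_big /=; apply: eq_bigr => s _.
  rewrite scaler_suml; apply: eq_bigr => t _.
  rewrite linearZ scalerA mulrC.
  rewrite /incidence; case: ifPn => [/andP[st _]|_]; last by rewrite mul0r !scale0r.
  case: ifPn => [/andP[tr _]|_]; last by rewrite mulr0 !scale0r.
  rewrite (restr0E st) (restr0E tr) (restr0E (fintype.subset_trans st tr)).
  by rewrite (restr_comp st tr (fintype.subset_trans st tr)).
rewrite big1// => s _.
by rewrite incidence_sum ?scale0r.
Qed.

Definition sheaf_complex : cochainComplex R :=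
  @CochainComplex R sheaf_cochains (fun k => @sheaf_codiff k : {linear _ -> _})
    sheaf_codiffK.

Definition sheaf_cohomology k : lmodType R := cohomology sheaf_complex k.

End SheafCohomology.

Section ZeroSheaf.
Context {m : nat} (X : simplicialComplex m) (R : comNzRingType).

Definition zero_sheaf : cellularSheaf X R :=
  @CellularSheaf m X R (fun=> 'rV[R]_0) (fun _ _ _ => idfun)
    (fun _ _ _ => erefl) (fun _ _ _ _ _ _ _ => erefl).

End ZeroSheaf.

Section Nerve.
Context {m : nat} {Y : Type} (V : 'I_m -> set Y).

Definition nerve_support (s : {set 'I_m}) : set Y := \bigcap_(i in [set` s]) V i.

Definition nerve_simplices : {set {set 'I_m}} :=
  [set s : {set 'I_m} | (s != finset.set0) && `[< nerve_support s !=set0 >]]%SET.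

Lemma support_anti (s t : {set 'I_m}) : s \subset t -> nerve_support t `<=` nerve_support s.
Proof. by move=> /fintype.subsetP st y ty i /= /st; exact: ty. Qed.

Lemma nerve_neq0 (s : {set 'I_m}) : s \in nerve_simplices -> s != finset.set0.
Proof. by rewrite inE => /andP[]. Qed.

Lemma nerve_face (s t : {set 'I_m}) : t \in nerve_simplices -> s \subset t ->
  s != finset.set0 -> s \in nerve_simplices.
Proof.
rewrite !inE => /andP[_ /asboolP[y ty]] st -> /=.
by apply/asboolP; exists y; exact: support_anti ty.
Qed.

Definition nerve : simplicialComplex m := SimplicialComplex nerve_neq0 nerve_face.

End Nerve.

Section Inclusion.
Context {X : topologicalType} (A B : set X) (AB : A `<=` B).

Definition set_incl (x : A) : B :=
  exist _ (set_val x) (mem_set (AB (set_mem (svalP x)))).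

Lemma set_incl_continuous : continuous set_incl.
Proof.
apply: continuous_comp_initial.
have -> : set_val \o set_incl = set_val by [].
exact: initial_continuous.
Qed.
HB.instance Definition _ :=
  isContinuous.Build (set_type A) (set_type B) set_incl set_incl_continuous.

End Inclusion.

Section LeraySheaf.
Context (K : realType) (R : comNzRingType) {X : topologicalType} {Y : Type}.
Variables (f : X -> Y) (m : nat) (V : 'I_m -> set Y) (n : nat).

Definition leray_stalk (s : simplex (nerve V)) : lmodType R :=
  singular_cohomology K R (set_type (f @^-1` nerve_support V (val s))) n.

Lemma leray_sub (s t : {set 'I_m}) : s \subset t ->
  f @^-1` nerve_support V t `<=` f @^-1` nerve_support V s.
Proof. by move=> st x; exact: support_anti. Qed.

Definition leray_restr (s t : simplex (nerve V)) (st : val s \subset val t) :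
    {linear leray_stalk s -> leray_stalk t} :=
  singular_pullback K R (set_incl (leray_sub st) : continuousType _ _) n.

Lemma leray_restr_id (s : simplex (nerve V)) (ss : val s \subset val s) x : leray_restr ss x = x.
Proof.
rewrite -[x]coh_class_repr /= coh_mapE; congr coh_class; apply: val_inj => /=.
apply/funext => u; rewrite /singular_comp; apply: f_equal.
by apply/continuousEP => p; apply: val_inj.
Qed.

Lemma leray_restr_comp (s l t : simplex (nerve V)) (sl : val s \subset val l)
  (lt : val l \subset val t) (st : val s \subset val t) x :
  leray_restr lt (leray_restr sl x) = leray_restr st x.
Proof.
rewrite -[x]coh_class_repr; move: (repr _) => z.
rewrite [leray_restr sl _]coh_mapE [leray_restr lt _]coh_mapE.
rewrite [leray_restr st _]coh_mapE; congr coh_class; apply: val_inj => /=.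
apply/funext => u; rewrite /singular_comp; apply: f_equal.
by apply/continuousEP => p; apply: val_inj.
Qed.

Definition leray_sheaf : cellularSheaf (nerve V) R :=
  CellularSheaf leray_restr_id leray_restr_comp.

End LeraySheaf.

(* The sheaf L^(n-1), with L^(-1) = 0. *)
Definition leray_sheaf_pred (K : realType) (R : comNzRingType) (X : topologicalType)
    (Y : Type) (f : X -> Y) (m : nat) (V : 'I_m -> set Y) (n : nat) :
    cellularSheaf (nerve V) R :=
  match n with
  | 0 => zero_sheaf (nerve V) R
  | j.+1 => leray_sheaf K R f V j
  end.

(* [A] is contractible within [U]: the inclusion of [A] in [U] is homotopic to a
   constant map. *)
Definition contractible_in (K : realType) (T : topologicalType) (A U : set T) : Prop :=
  exists (p : T) (h : K * T -> T),
    {within `[0, 1]%classic `*` A, continuous h} /\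
    forall x, A x -> [/\ h (0, x) = x, h (1, x) = p &
      forall t, 0 <= t <= 1 -> U (h (t, x))].

(* Borsuk's definition; it holds in particular when every point has a basis of
   contractible neighbourhoods. *)
Definition locally_contractible (K : realType) (T : topologicalType) : Prop :=
  forall (x : T) (U : set T), nbhs x U ->
    exists W : set T, [/\ nbhs x W, W `<=` U & contractible_in K W U].

(* Main.v *)
(* Write U_v for the preimage of a vertex v of the nerve and U_e for that of an edge e.
   A singular simplex of X lies in at most two of the U_v, since triple intersections
   are empty, so the cochains on simplices lying in some U_v, the products of the
   C^*(U_v) and the products of the C^*(U_e) form a short exact sequence.  By iterated
   barycentric subdivision the complex of cochains vanishing on those small simplices is
   acyclic, so the first complex computes H^*(X).  The long exact sequence yields
     0 -> H^1(N; L^(n-1)) -> H^n(X) -> H^0(N; L^n) -> 0,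
   which splits because R is a field. *)
Require Import Defs.
From HB Require Import structures.
From mathcomp Require Import all_boot all_order all_algebra zify ring.
From mathcomp Require Import all_classical all_reals all_analysis.

Set Implicit Arguments.
Unset Strict Implicit.
Unset Printing Implicit Defensive.

Import Order.TTheory GRing.Theory Num.Theory.
Import numFieldNormedType.Exports.

Local Open Scope classical_set_scope.
Local Open Scope ring_scope.

(** * Barycentric subdivision on lists of vertices *)

(** Cochains are arbitrary functions on singular simplices, so no single number of subdivisions
    serves all simplices at once; acyclicity rests on a sum that is finite only at each simplex.
    Subdivision is carried out on lists of vertices, where the homotopy identity is pure algebra,
    and affine maps transport it to singular simplices.

    Every cochain on a subspace extends by zero to [X], so classes on the [U_v] and [U_e] are
    represented by cochains of [X] that are compared after restriction. Gluing such cochains over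
    the [U_v] says nothing about large simplices, so the result need not be closed there; acyclicity
    supplies the correction.

    The connecting map enters the splitting only as a graph: linearity, totality and the conditions
    at 0 are what the diagram chases produce, with no choice of representatives to compare. *)

Definition del (T : Type) i (w : seq T) := take i w ++ drop i.+1 w.

Lemma size_del (T : Type) i (w : seq T) : (i < size w)%N -> size (del i w) = (size w).-1.
Proof. by move=> iw; rewrite size_cat size_take iw size_drop; lia. Qed.

Lemma nth_del (T : Type) (x0 : T) i (w : seq T) j : (i <= size w)%N ->
  nth x0 (del i w) j = nth x0 w (bump i j).
Proof.
move=> iw; rewrite nth_cat size_takel// /bump.
case: (ltnP j i) => ji; first by rewrite nth_take// add0n.
by rewrite nth_drop; congr nth; lia.
Qed.

Lemma map_del (T U : Type) (g : T -> U) i w : map g (del i w) = del i (map g w).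
Proof. by rewrite /del map_cat map_take map_drop. Qed.

Section ListCochains.
Context {R : comNzRingType} {P : Type}.
Implicit Types (c : seq P -> R) (w u : seq P).

(** The augmented simplicial coboundary: the face of a one-vertex list is [[::]]. Peeling off the
    head makes the boundary formula of a cone over [x] hold by computation. *)
Fixpoint list_codiff c w : R :=
  if w is x :: w' then c w' - list_codiff (fun u => c (x :: u)) w' else 0.

Lemma list_codiffE c w : list_codiff c w = \sum_(i < size w) (-1) ^+ i * c (del i w).
Proof.
elim: w c => [|x w IH] c /=; first by rewrite big_ord0.
rewrite big_ord_recl expr0 mul1r /del /= drop0; congr (_ + _).
rewrite IH -sumrN; apply: eq_bigr => i _.
by rewrite /= /bump add1n exprS mulN1r mulNr.
Qed.

Lemma eq_list_codiff c c' w :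
  (forall i, (i < size w)%N -> c (del i w) = c' (del i w)) ->
  list_codiff c w = list_codiff c' w.
Proof.
by move=> e; rewrite !list_codiffE; apply: eq_bigr => i _; rewrite e.
Qed.

Lemma list_codiffB c c' w :
  list_codiff (fun u => c u - c' u) w = list_codiff c w - list_codiff c' w.
Proof.
by rewrite !list_codiffE -sumrB; apply: eq_bigr => i _; rewrite mulrBr.
Qed.

Lemma list_codiffK c w : list_codiff (list_codiff c) w = 0.
Proof.
elim: w c => [//|x w IH] c; rewrite /= list_codiffB IH subr0 subrr//.
Qed.

Variable bary : seq P -> P.

(* The cone operator of the usual chain-level construction becomes, on cochains,
   [c |-> c (b :: _)]; the index is the number of vertices. *)
Fixpoint subdiv k c w : R :=
  if k is k'.+1 then
    list_codiff (subdiv k' (fun u => c (bary w :: u))) w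
  else c w.

(** Dual to the chain homotopy [T w = b (w - T (d w))], where [b] cones from the barycenter of
    [w]. *)
Fixpoint subdiv_homotopy k c w : R :=
  if k is k'.+1 then
    c (bary w :: w) - list_codiff (subdiv_homotopy k' (fun u => c (bary w :: u))) w
  else 0.

Lemma subdiv_homotopyB k c c' w :
  subdiv_homotopy k (fun u => c u - c' u) w =
  subdiv_homotopy k c w - subdiv_homotopy k c' w.
Proof.
elim: k c c' w => [|k IH] c c' w /=; first by rewrite subr0.
transitivity (c (bary w :: w) - c' (bary w :: w) -
  (list_codiff (subdiv_homotopy k (fun u => c (bary w :: u))) w -
   list_codiff (subdiv_homotopy k (fun u => c' (bary w :: u))) w)); last by ring.
by rewrite -list_codiffB; congr (_ - _); apply: eq_list_codiff => i _; exact: IH.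
Qed.

(** After expanding the coboundary of the cone and using the induction hypothesis for [cb] on the
    faces of [w], everything cancels except a double coboundary, which is 0. *)
Lemma subdiv_homotopyP k c w : size w = k ->
  list_codiff (subdiv_homotopy k.-1 c) w + subdiv_homotopy k (list_codiff c) w =
  c w - subdiv k c w.
Proof.
elim: k c w => [|k IH] c w wk /=; first by rewrite (size0nil wk)/= addr0 subrr.
set b := bary w; set cb := fun u => c (b :: u).
have -> : list_codiff (subdiv_homotopy k (fun u => c u - list_codiff cb u)) w =
    list_codiff (subdiv_homotopy k c) w - (list_codiff cb w - subdiv k.+1 c w).
  transitivity (list_codiff (fun u => subdiv_homotopy k c u -
      (cb u - subdiv k cb u - list_codiff (subdiv_homotopy k.-1 cb) u)) w).
    apply: eq_list_codiff => i; rewrite wk => ik.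
    rewrite subdiv_homotopyB -IH ?size_del ?wk//.
    by rewrite addrAC addrN add0r.
  by rewrite !list_codiffB list_codiffK subr0.
rewrite /= -/cb; move: (list_codiff _ _) (list_codiff _ _) (list_codiff _ _) => p q r; ring.
Qed.

Lemma subdiv0 k c w : (forall u, c u = 0) -> subdiv k c w = 0.
Proof.
elim: k c w => //= k IH c w c0; rewrite list_codiffE big1// => i _.
by rewrite IH ?mulr0.
Qed.

Lemma subdiv_homotopy0 k c w : (forall u, c u = 0) -> subdiv_homotopy k c w = 0.
Proof.
elim: k c w => //= k IH c w c0; rewrite c0 sub0r list_codiffE big1 ?oppr0// => i _.
by rewrite IH ?mulr0.
Qed.

(** For [k] the length of [w], these are the simplices of the barycentric subdivision: flags of
    faces of [w], read as lists of barycenters in decreasing dimension. *)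
Fixpoint subdivided k w u : Prop :=
  if k is k'.+1 then
    exists2 i, (i < size w)%N & exists2 u', subdivided k' (del i w) u' & u = bary w :: u'
  else u = w.

Lemma subdiv_eq0 k c w : (forall u, subdivided k w u -> c u = 0) -> subdiv k c w = 0.
Proof.
elim: k c w => /= [c w -> //|k IH c w c0]; rewrite list_codiffE big1// => i _.
by rewrite IH ?mulr0// => u wu; apply: c0; exists i => //; exists u.
Qed.

End ListCochains.

Section Naturality.
Context {R : comNzRingType} {P Q : Type} (baryP : seq P -> P) (baryQ : seq Q -> Q).
Variable g : P -> Q.
Hypothesis g_bary : forall w, (0 < size w)%N -> g (baryP w) = baryQ (map g w).
Implicit Types (c : seq Q -> R) (w : seq P).

Lemma subdiv_map k c w : size w = k ->
  subdiv baryP k (fun u => c (map g u)) w = subdiv baryQ k c (map g w).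
Proof.
elim: k c w => //= k IH c w wk.
rewrite !list_codiffE size_map; apply: eq_bigr => i _.
by rewrite g_bary ?wk// -map_del -IH// size_del// wk.
Qed.

Lemma subdiv_homotopy_map k c w : size w = k ->
  subdiv_homotopy baryP k (fun u => c (map g u)) w = subdiv_homotopy baryQ k c (map g w).
Proof.
elim: k c w => //= k IH c w wk.
rewrite !list_codiffE size_map g_bary ?wk//; congr (_ - _); apply: eq_bigr => i _.
by rewrite -map_del -IH// size_del// wk.
Qed.

End Naturality.

(** * Affine simplices and their mesh *)

Section AffineSimplices.
Context {K : realType}.
Local Notation Simplex := (std_simplex K).

Lemma vertex_in n (i : 'I_n.+1) : delta_mx 0 i \in Simplex n.
Proof.
apply/mem_set; split=> [j|]; first by rewrite mxE ler0n.
rewrite (bigD1 i)//= mxE !eqxx big1 ?addr0// => j /negbTE ji.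
by rewrite mxE ji andbF.
Qed.

Definition vertex n (i : 'I_n.+1) : Simplex n := exist _ (delta_mx 0 i) (vertex_in i).

Definition vertices n : seq (Simplex n) := [seq vertex i | i <- enum 'I_n.+1].

Lemma size_vertices n : size (vertices n) = n.+1.
Proof. by rewrite size_map size_enum_ord. Qed.

(** Missing entries of [w] default to a vertex, which keeps the value in the simplex for every
    list. *)
Definition affine_fun m n (w : seq (Simplex m)) (x : 'rV[K]_n.+1) : 'rV[K]_m.+1 :=
  \sum_i x 0 i *: set_val (nth (vertex ord0) w i).

Lemma simplex_ge0 n (x : Simplex n) i : 0 <= set_val x 0 i.
Proof. by have /set_mem[x0 x1] := svalP x. Qed.

Lemma simplex_sum1 n (x : Simplex n) : \sum_i set_val x 0 i = 1.
Proof. by have /set_mem[x0 x1] := svalP x. Qed.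

Lemma affine_fun_in m n w (x : Simplex n) : affine_fun w (set_val x) \in Simplex m.
Proof.
apply/mem_set; split=> [j|].
  rewrite summxE; apply: sumr_ge0 => i _; rewrite mxE.
  by apply: mulr_ge0; exact: simplex_ge0.
under eq_bigr do rewrite summxE; rewrite exchange_big /= -(simplex_sum1 x).
apply: eq_bigr => i _; under eq_bigr do rewrite mxE.
by rewrite -mulr_sumr simplex_sum1 mulr1.
Qed.

Definition affine m n (w : seq (Simplex m)) (x : Simplex n) : Simplex m :=
  exist _ (affine_fun w (set_val x)) (affine_fun_in w x).

Lemma affine_fun_continuous m n (w : seq (Simplex m)) :
  continuous (affine_fun (n := n) w).
Proof.
apply: continuous_big => [|i _ x]; first exact: add_continuous.
apply: cvgZr_tmp; first exact: nbhs_filter.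
exact: coord_continuous.
Qed.

Lemma affine_continuous m n (w : seq (Simplex m)) : continuous (affine (n := n) w).
Proof.
apply: continuous_comp_initial.
have -> : set_val \o affine (n := n) w = affine_fun w \o set_val by [].
move=> x; apply: continuous_comp; first exact: initial_continuous.
exact: affine_fun_continuous.
Qed.
HB.instance Definition _ m n (w : seq (Simplex m)) :=
  isContinuous.Build _ _ (affine (n := n) w) (@affine_continuous m n w).

Lemma center_in n : const_mx n.+1%:R^-1 \in Simplex n.
Proof.
apply/mem_set; split=> [j|]; first by rewrite mxE invr_ge0.
under eq_bigr do rewrite mxE.
by rewrite sumr_const card_ord -[LHS]mulr_natr mulVf ?pnatr_eq0.
Qed.

Definition barycenter m (w : seq (Simplex m)) : Simplex m :=
  affine w (exist _ (const_mx (size w).-1.+1%:R^-1) (center_in (size w).-1)).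

Lemma affine_affine l m n (v : seq (Simplex l)) (w : seq (Simplex m)) (x : Simplex n) :
  size w = n.+1 -> affine v (affine w x) = affine (map (affine v) w) x.
Proof.
move=> wn; apply: val_inj => /=; rewrite /affine_fun.
under [RHS]eq_bigr => i _.
  rewrite (nth_map (vertex ord0)) ?wn//= /affine_fun scaler_sumr.
  over.
rewrite exchange_big /=; apply: eq_bigr => j _.
by rewrite summxE scaler_suml; apply: eq_bigr => i _; rewrite mxE scalerA.
Qed.

Lemma affine_barycenter l m (v : seq (Simplex l)) (w : seq (Simplex m)) :
  (0 < size w)%N -> affine v (barycenter w) = barycenter (map (affine v) w).
Proof.
move=> w0; rewrite affine_affine ?prednK//; apply: val_inj.
by rewrite /= /affine_fun size_map.
Qed.

Lemma affine_vertices n (x : Simplex n) : affine (vertices n) x = x.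
Proof.
apply: val_inj => /=; rewrite /affine_fun [RHS]row_sum_delta.
by apply: eq_bigr => i _; rewrite (nth_map ord0) ?size_enum_ord// nth_ord_enum.
Qed.

Lemma map_affine_vertices m n (w : seq (Simplex m)) : size w = n.+1 ->
  map (affine w) (vertices n) = w.
Proof.
move=> wn; apply: (@eq_from_nth _ (vertex ord0)); rewrite size_map size_vertices ?wn//.
move=> i ilt; rewrite (nth_map (vertex ord0)) ?size_vertices//.
rewrite (nth_map ord0) ?size_enum_ord// (nth_ord_enum _ (Ordinal ilt)).
apply: val_inj => /=; rewrite /affine_fun (bigD1 (Ordinal ilt))//= mxE !eqxx scale1r.
by rewrite big1 ?addr0// => j /negbTE ji; rewrite mxE ji scale0r.
Qed.

Lemma affine_face m n (w : seq (Simplex m)) (i : 'I_n.+2) (x : Simplex n) :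
  size w = n.+2 -> affine w (face i x) = affine (del i w) x.
Proof.
move=> wn; apply: val_inj => /=; rewrite /affine_fun (bigD1_ord i)//=.
rewrite mxE unlift_none scale0r add0r; apply: eq_bigr => j _.
by rewrite mxE liftK /= nth_del// wn ltnW.
Qed.

End AffineSimplices.

Section Mesh.
Context {K : realType}.
Local Notation Simplex := (std_simplex K).

Lemma mem_del (T : eqType) i (w : seq T) : {subset del i w <= w}.
Proof. by move=> z; rewrite mem_cat => /orP[/mem_take|/mem_drop]. Qed.

Lemma affine_ball m n (w : seq (Simplex m)) (x : Simplex n) (y : 'rV[K]_m.+1) r :
  size w = n.+1 -> {in w, forall z, `|y - set_val z| <= r} ->
  `|y - set_val (affine w x)| <= r.
Proof.
move=> wn wr.
have -> : y - set_val (affine w x) =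
    \sum_i set_val x 0 i *: (y - set_val (nth (vertex ord0) w i)).
  under eq_bigr do rewrite scalerBr.
  by rewrite sumrB -scaler_suml simplex_sum1 scale1r.
apply: (le_trans (ler_norm_sum _ _ _)).
rewrite -[leRHS]mul1r -(simplex_sum1 x) mulr_suml; apply: ler_sum => i _.
rewrite normrZ ger0_norm ?simplex_ge0//; apply: ler_wpM2l; first exact: simplex_ge0.
by apply: wr; rewrite mem_nth// wn.
Qed.

Lemma barycenter_ball m (w : seq (Simplex m)) (y : 'rV[K]_m.+1) r :
  (0 < size w)%N -> {in w, forall z, `|y - set_val z| <= r} ->
  `|y - set_val (barycenter w)| <= r.
Proof. by move=> w0; apply: affine_ball; rewrite prednK. Qed.

Lemma subdivided_ball m k (w u : seq (Simplex m)) (y : 'rV[K]_m.+1) r :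
  size w = k -> subdivided (@barycenter K m) k w u ->
  {in w, forall z, `|y - set_val z| <= r} -> {in u, forall z, `|y - set_val z| <= r}.
Proof.
elim: k w u => [w u _ -> //|k IH w u wk [i iw [u' wu' ->]] wr z].
rewrite inE => /orP[/eqP->|].
  by apply: barycenter_ball => //; rewrite wk.
apply: (IH _ _ _ wu'); first by rewrite size_del// wk.
by move=> t /mem_del; exact: wr.
Qed.

Definition spread m (w : seq (Simplex m)) (d : K) :=
  {in w &, forall x y, `|set_val x - set_val y| <= d}.

(** In the average of the differences to [z] the term of [z] itself vanishes: [k + 1] vertices give
    the factor [k / (k + 1) = 1 - 1 / (k + 1)], which increases with [k]. *)
Lemma barycenter_dist m n (w : seq (Simplex m)) d z : 0 <= d ->
  (size w <= n.+1)%N -> spread w d -> z \in w ->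
  `|set_val (barycenter w) - set_val z| <= (1 - n.+1%:R^-1) * d.
Proof.
move=> d0 wn wd zw; have w0 : (0 < size w)%N by case: w zw {wd wn}.
have iw := zw; rewrite -index_mem in iw; rewrite -(prednK w0) in iw.
pose i := Ordinal iw; set k := (size w).-1 in i *.
have zE : nth (vertex ord0) w i = z by exact: nth_index.
have -> : set_val (barycenter w) - set_val z =
    \sum_(j < k.+1 | j != i) k.+1%:R^-1 *: (set_val (nth (vertex ord0) w j) - set_val z).
  rewrite [RHS](_ : _ = \sum_(j < k.+1) k.+1%:R^-1 *:
      (set_val (nth (vertex ord0) w j) - set_val z)).
    under [RHS]eq_bigr do rewrite scalerBr.
    rewrite sumrB -scaler_suml sumr_const card_ord -[_^-1 *+ _]mulr_natr mulVf ?pnatr_eq0//.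
    by rewrite scale1r /= /affine_fun; congr (_ - _); apply: eq_bigr => j _; rewrite mxE.
  by rewrite [RHS](bigD1 i)//= zE subrr scaler0 add0r.
apply: (le_trans (ler_norm_sum _ _ _)).
apply: (@le_trans _ _ (\sum_(j < k.+1 | j != i) k.+1%:R^-1 * d)).
  apply: ler_sum => j _; rewrite normrZ ger0_norm ?invr_ge0//.
  apply: ler_wpM2l; first by rewrite invr_ge0.
  by apply: wd => //; rewrite mem_nth// -[X in (_ < X)%N](prednK w0).
rewrite sumr_const -mulrnAl; apply: ler_wpM2r => //.
rewrite cardC1 card_ord /= -mulr_natr.
have -> : k.+1%:R^-1 * k%:R = 1 - k.+1%:R^-1 :> K.
  have : k.+1%:R != 0 :> K by rewrite pnatr_eq0.
  by rewrite -natr1 => k0; field.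
rewrite lerD2l lerN2 lef_pV2 ?posrE ?ltr0n// ler_nat.
by rewrite (leq_trans _ wn)// -[X in (_ <= X)%N](prednK w0).
Qed.

(** The factor is tied to [n], not to [k], so that it stays the same along the recursion on
    faces. *)
Lemma subdivided_spread m n k (w u : seq (Simplex m)) d : 0 <= d ->
  size w = k -> (k <= n.+1)%N -> subdivided (@barycenter K m) k w u ->
  spread w d -> spread u ((1 - n.+1%:R^-1) * d).
Proof.
move=> d0; elim: k w u => [w u /size0nil-> _ -> //|k IH w u wk kn [i iw [u' wu' ->]] wd].
have dw : size (del i w) = k by rewrite size_del// wk.
have u'd : spread u' ((1 - n.+1%:R^-1) * d).
  apply: (IH _ _ dw _ wu'); first exact: ltnW.
  by move=> x y /mem_del xw /mem_del yw; exact: wd.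
have bu' z : z \in u' -> `|set_val (barycenter w) - set_val z| <= (1 - n.+1%:R^-1) * d.
  apply: (subdivided_ball dw wu') => t /mem_del.
  by apply: barycenter_dist => //; rewrite wk.
move=> x y; rewrite !inE => /orP[/eqP->|xu] /orP[/eqP->|yu].
- by rewrite subrr normr0 mulr_ge0// subr_ge0 invf_le1 ?ltr0n// ler1n.
- exact: bu'.
- by rewrite distrC; exact: bu'.
- exact: u'd.
Qed.

Lemma simplex_norm_le1 m (x : Simplex m) : `|set_val x| <= 1.
Proof.
rewrite [leLHS]mx_normrE; apply: bigmax_le => // -[i j] _ /=.
rewrite (ord1 i) ger0_norm ?simplex_ge0// -(simplex_sum1 x) (bigD1 j)//= lerDl.
by apply: sumr_ge0 => k _; exact: simplex_ge0.
Qed.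

Lemma simplex_spread m (w : seq (Simplex m)) : spread w 2.
Proof.
move=> x y _ _; apply: (le_trans (ler_normB _ _)).
by rewrite -[2]/(1 + 1) lerD// simplex_norm_le1.
Qed.

Lemma simplex_compact n : compact (Simplex n).
Proof.
apply: bounded_closed_compact.
  exists 1; split=> // M M1 x xS; apply: le_trans (ltW M1).
  exact: (simplex_norm_le1 (exist _ x (mem_set xS))).
have -> : Simplex n = (\bigcap_i [set x | 0 <= x 0 i]) `&` [set x | \sum_i x 0 i = 1].
  apply/seteqP; split=> [x [x0 x1]|x [x0 x1]]; split=> // i; first by move=> _; exact: x0.
  exact: x0.
apply: closedI.
  apply: closed_bigI => i _.
  apply: (@preimage_closed _ _ (fun x : 'rV[K]_n.+1 => x 0 i) [set y | 0 <= y]).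
    by move=> x _; exact: coord_continuous.
  exact: closed_ge.
apply: (@preimage_closed _ _ (fun x : 'rV[K]_n.+1 => \sum_i x 0 i) [set y | y = 1]);
  last exact: closed_eq.
move=> x _; move: x; apply: continuous_big => [|i _ x]; first exact: add_continuous.
exact: coord_continuous.
Qed.

(** The cover is pulled back to the compact simplex; the near-covering form of compactness, with [e]
    in the filter [0^'+], gives one [e] for all points. *)
Lemma lebesgue_number n (T : topologicalType) (s : continuousType (Simplex n) T)
    (I : Type) (U : I -> set T) :
  (forall i, open (U i)) -> (forall x, exists i, U i x) ->
  exists2 e : K, 0 < e & forall x : Simplex n, exists i, forall y : Simplex n,
    `|set_val x - set_val y| < e -> U i (s y).
Proof.
move=> Uo Ucov.
have /compact_near_coveringP cov := @simplex_compact n.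
have := cov K 0^'+ (fun e x => exists i, forall y : Simplex n,
    `|x - set_val y| < e -> U i (s y)) _.
case.
  move=> x xS; pose xx : Simplex n := exist _ x (mem_set xS).
  have [i Ui] := Ucov (s xx).
  (* The simplex carries the initial topology, so the preimage of [U i] is the trace of an open set
     [W] of row vectors. *)
  have /continuousP/(_ _ (Uo i))[W Wo WE] := @cts_fun _ _ s.
  have Wx : W x by rewrite -[x]/(set_val xx) -[W _]/((set_val @^-1` W) xx) WE.
  have /nbhs_ballP[r /= r0 rW] : nbhs x W by exact: open_nbhs_nbhs.
  exists ([set x' | `|x - x'| < r / 2], [set e | e < r / 2]) => /=.
    split; last by apply: nbhs_right_lt; rewrite divr_gt0.
    apply/nbhs_ballP; exists (r / 2); first by rewrite /= divr_gt0.
    by move=> x'; rewrite -ball_normE.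
  move=> [x' e] /= [x'r er]; exists i => y yx'.
  rewrite -[U i _]/((s @^-1` U i) y) -WE; apply: rW; rewrite -ball_normE /=.
  rewrite (le_lt_trans (ler_distD x' _ _))// (splitr r) ltrD//.
  exact: lt_trans er.
move=> r /= r0 rP; exists (r / 2); first by rewrite divr_gt0.
move=> x; apply: (rP (r / 2)) => /=.
- by rewrite sub0r normrN gtr0_norm ?divr_gt0// ltr_pdivrMr// ltr_pMr// ltr1n.
- by rewrite divr_gt0.
- by apply: set_mem; exact: (svalP x).
Qed.

End Mesh.

(** * Cochains vanishing on small simplices *)

Section SmallSimplices.
Context {K : realType} {R : comNzRingType} {T : topologicalType}.
Local Notation Simplex := (std_simplex K).
Local Notation cochain := (singular_cochains K R T).
Local Notation simplex_in := (singular_simplex K T).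
Local Notation bary m := (@barycenter K m).

(* Evaluates [c] along [s] on affine simplices of the model simplex, seen as vertex lists;
   lists of the wrong length get the value 0. *)
Definition affine_simplices m n (s : simplex_in m) (c : cochain n) (w : seq (Simplex m)) : R :=
  if size w == n.+1 then c (s \o affine w : continuousType (Simplex n) T) else 0.

Lemma affine_simplices_codiff m n (s : simplex_in m) (c : cochain n) :
  affine_simplices s (singular_codiff c) = list_codiff (affine_simplices s c).
Proof.
apply/funext => w; rewrite /affine_simplices list_codiffE; case: eqP => wn.
  rewrite /singular_codiff wn; apply: eq_bigr => i _.
  rewrite size_del wn//= eqxx; congr (_ * c _).
  by apply/continuousEP => x /=; rewrite affine_face.
rewrite big1// => i _; rewrite size_del//; case: eqP => [wn1|_]; rewrite ?mulr0//.
by case: wn; rewrite -wn1 prednK// (leq_ltn_trans _ (ltn_ord i)).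
Qed.

Lemma affine_simplices_affine l m n (s : simplex_in m) (v : seq (Simplex m)) (c : cochain n) w :
  affine_simplices (s \o affine v : continuousType (Simplex l) T) c w =
  affine_simplices s c (map (affine v) w).
Proof.
rewrite /affine_simplices size_map; case: eqP => // wn; congr c.
by apply/continuousEP => x /=; rewrite affine_affine.
Qed.

Definition singular_subdiv n (c : cochain n) : cochain n :=
  fun s => subdiv (bary n) n.+1 (affine_simplices s c) (vertices n).

Definition singular_homotopy n (c : cochain n.+1) : cochain n :=
  fun s => subdiv_homotopy (bary n) n.+1 (affine_simplices s c) (vertices n).

(** Naturality along [affine w], starting from the standard vertices; it turns iterated subdivision
    of cochains into subdivision of vertex lists. *)
Lemma affine_simplices_subdiv m n (s : simplex_in m) (c : cochain n) w : size w = n.+1 ->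
  affine_simplices s (singular_subdiv c) w = subdiv (bary m) n.+1 (affine_simplices s c) w.
Proof.
move=> wn; rewrite {1}/affine_simplices wn eqxx /singular_subdiv.
rewrite -[in RHS](map_affine_vertices wn).
rewrite -(subdiv_map (@affine_barycenter K m n w)) ?size_vertices//.
congr subdiv; apply/funext => u; exact: affine_simplices_affine.
Qed.

Lemma affine_simplices_homotopy m n (s : simplex_in m) (c : cochain n.+1) w :
  size w = n.+1 ->
  affine_simplices s (singular_homotopy c) w =
  subdiv_homotopy (bary m) n.+1 (affine_simplices s c) w.
Proof.
move=> wn; rewrite {1}/affine_simplices wn eqxx /singular_homotopy.
rewrite -[in RHS](map_affine_vertices wn).
rewrite -(subdiv_homotopy_map (@affine_barycenter K m n w)) ?size_vertices//.
congr subdiv_homotopy; apply/funext => u; exact: affine_simplices_affine.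
Qed.

Lemma affine_simplices_vertices n (s : simplex_in n) (c : cochain n) :
  affine_simplices s c (vertices n) = c s.
Proof.
rewrite /affine_simplices size_vertices eqxx; congr c.
by apply/continuousEP => x /=; rewrite affine_vertices.
Qed.

Lemma singular_homotopyP n (c : cochain n.+1) :
  singular_codiff (singular_homotopy c) + singular_homotopy (singular_codiff c) =
  c - singular_subdiv c.
Proof.
apply/funext => s.
transitivity (affine_simplices s (singular_codiff (singular_homotopy c)) (vertices n.+1) +
  singular_homotopy (singular_codiff c) s); first by rewrite affine_simplices_vertices.
rewrite affine_simplices_codiff /singular_homotopy affine_simplices_codiff.
transitivity (affine_simplices s c (vertices n.+1) -
  subdiv (bary n.+1) n.+2 (affine_simplices s c) (vertices n.+1)); last first.
  by rewrite affine_simplices_vertices.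
rewrite -subdiv_homotopyP ?size_vertices//; congr (_ + _).
apply: eq_list_codiff => i; rewrite size_vertices => ilt.
by apply: affine_simplices_homotopy; rewrite size_del ?size_vertices.
Qed.

Lemma singular_homotopy_cocycle n (c : cochain n.+1) : singular_codiff c = 0 ->
  singular_codiff (singular_homotopy c) = c - singular_subdiv c.
Proof.
move=> c0; rewrite -singular_homotopyP c0.
rewrite [X in _ = _ + X](_ : _ = 0) ?addr0//; apply/funext => s.
apply: (@subdiv_homotopy0 R _ (bary n.+1) n.+2) => u.
by rewrite /affine_simplices; case: ifP.
Qed.

(** Read off from the homotopy identity and [d d = 0], instead of proving that subdivision commutes
    with the coboundary. *)
Lemma singular_subdiv_cocycle n (c : cochain n.+1) :
  singular_codiff c = 0 -> singular_codiff (singular_subdiv c) = 0.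
Proof.
move=> c0.
have -> : singular_subdiv c = c - singular_codiff (singular_homotopy c).
  by rewrite singular_homotopy_cocycle// opprB addrC subrK.
by rewrite raddfB /= c0 singular_codiffK subr0.
Qed.

Context {I : Type} (U : I -> set T).

Definition small n (s : simplex_in n) := exists i, forall x, U i (s x).

Definition vanishes_on_small n (c : cochain n) := forall s, small s -> c s = 0.

Lemma small_affine m n (s : simplex_in m) (w : seq (Simplex m)) :
  small s -> small (s \o affine w : continuousType (Simplex n) T).
Proof. by move=> [i sU]; exists i => x; exact: sU. Qed.

Lemma affine_simplices_small m n (s : simplex_in m) (c : cochain n) :
  vanishes_on_small c -> small s -> affine_simplices s c = fun=> 0.
Proof.
move=> c0 ss; apply/funext => w; rewrite /affine_simplices; case: ifP => // _.
by apply: c0; exact: small_affine.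
Qed.

Lemma singular_subdiv_small n (c : cochain n) :
  vanishes_on_small c -> vanishes_on_small (singular_subdiv c).
Proof.
by move=> c0 s ss; rewrite /singular_subdiv (affine_simplices_small c0 ss) subdiv0.
Qed.

Lemma singular_homotopy_small n (c : cochain n.+1) :
  vanishes_on_small c -> vanishes_on_small (singular_homotopy c).
Proof.
by move=> c0 s ss; rewrite /singular_homotopy (affine_simplices_small c0 ss) subdiv_homotopy0.
Qed.

Hypotheses (Uo : forall i, open (U i)) (Ucov : forall x, exists i, U i x).

(** The lists that matter have [n + 1] vertices whatever the dimension [m] of [s], so the factor [q]
    depends on [n] only; [s] enters through its Lebesgue number [e]. *)
Lemma iter_subdiv_eventually0 m n (s : simplex_in m) (c : cochain n) :
  vanishes_on_small c ->
  exists N, forall i, (N <= i)%N ->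
    affine_simplices s (iter i (@singular_subdiv n) c) = fun=> 0.
Proof.
move=> c0; have [e e0 eU] := lebesgue_number s Uo Ucov.
pose q : K := 1 - n.+1%:R^-1.
have q0 : 0 <= q by rewrite subr_ge0 invf_le1 ?ltr0n// ler1n.
have q1 : q < 1 by rewrite gtrDl oppr_lt0 invr_gt0.
(* One subdivision turns the spread [d] into [q * d] and uses up one iterate, so [q ^+ i * d] is
   constant along the induction. *)
have mesh i d w : 0 <= d -> spread w d -> q ^+ i * d < e ->
    affine_simplices s (iter i (@singular_subdiv n) c) w = 0.
  elim: i d w => [|i IH] d w d0 wd de.
    rewrite /affine_simplices; case: eqP => //= wn; apply: c0.
    have w0 : nth (vertex ord0) w 0 \in w by rewrite mem_nth// wn.
    have [j jU] := eU (nth (vertex ord0) w 0); exists j => x; apply: jU.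
    rewrite expr0 mul1r in de; apply: le_lt_trans de.
    by apply: affine_ball => // z zw; exact: wd.
  have [wn|wn] := eqVneq (size w) n.+1; last by rewrite /affine_simplices (negbTE wn).
  rewrite iterS affine_simplices_subdiv//; apply: subdiv_eq0 => u wu.
  apply: (IH (q * d)); first exact: mulr_ge0.
    exact: (subdivided_spread d0 wn (leqnn _) wu).
  by rewrite mulrA -exprSr.
(* The constant 2 is the diameter bound of [simplex_spread]. *)
have : (fun i => q ^+ i * 2) @ \oo --> (0 * 2 : K).
  by apply: cvgMr_tmp; apply: cvg_expr; rewrite ger0_norm.
rewrite mul0r => /cvgr_lt /(_ e e0)[N _ NP].
exists N => i Ni; apply/funext => w; apply: (mesh i 2) => //; last exact: NP.
exact: simplex_spread.
Qed.

(* [b] is the sum of [T (S ^ i c)] over all [i], where [S] is subdivision and [T] the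
   homotopy: it is pointwise finite, because subdividing a given simplex often enough
   makes it small, where [c] vanishes. *)
Theorem vanishing_cochains_acyclic n (c : cochain n.+1) :
  singular_codiff c = 0 -> vanishes_on_small c ->
  exists2 b : cochain n, singular_codiff b = c & vanishes_on_small b.
Proof.
move=> cK c0.
pose ci i := iter i (@singular_subdiv n.+1) c.
have ciK i : singular_codiff (ci i) = 0.
  by elim: i => //= i IH; exact: singular_subdiv_cocycle.
have ci0 i : vanishes_on_small (ci i).
  by elim: i => //= i IH; exact: singular_subdiv_small.
pose P k (s : simplex_in k) N := forall i, (N <= i)%N -> affine_simplices s (ci i) = fun=> 0.
(* Used in two dimensions: on [n]-simplices the bound ends the sum defining [b], on [n.+1]-simplices
   it kills the remainder of the telescoping sum. *)
have exN k (s : simplex_in k) : {N | P k s N}.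
  by apply: cid; exact: iter_subdiv_eventually0.
pose N k s := sval (exN k s).
have NP k s : P k s (N k s) by exact: (svalP (exN k s)).
pose b : cochain n := fun s => \sum_(i < N n s) singular_homotopy (ci i) s.
have bE s M : (N n s <= M)%N -> b s = \sum_(i < M) singular_homotopy (ci i) s.
  move=> NM; rewrite /b (big_ord_widen _ (fun i => singular_homotopy (ci i) s) NM).
  rewrite [RHS](bigID (fun i : 'I_M => (i < N n s)%N))/= [X in _ + X]big1 ?addr0// => i.
  by rewrite -leqNgt => Ni; rewrite /singular_homotopy (NP n s) ?subdiv_homotopy0.
exists b; last first.
  by move=> s ss; apply: big1 => i _; exact: singular_homotopy_small.
apply/funext => s.
(* A bound valid for [s] and all its faces: the coboundary of [b] at [s] is then that of one finite
   sum, which telescopes to [c - ci M]. *)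
pose M := maxn (N n.+1 s) (\max_(i < n.+2) N n (s \o face i : continuousType _ _)).
have -> : singular_codiff b s = singular_codiff (\sum_(i < M) singular_homotopy (ci i)) s.
  apply: eq_bigr => i _; congr (_ * _); rewrite (bE _ M) ?fct_sumE//.
  by rewrite leq_max; apply/orP; right; exact: (leq_bigmax i).
rewrite (raddf_sum (@singular_codiff K R T n)) /=.
under eq_bigr do rewrite singular_homotopy_cocycle//.
rewrite -(big_mkord xpredT (fun i => ci i - ci i.+1)).
rewrite (@telescope_sumr_eq _ 0 M (fun i => - ci i))//; last by move=> i _; rewrite opprK addrC.
rewrite opprK /= addrC; transitivity (c s - ci M s); first by [].
rewrite -(affine_simplices_vertices s (ci M)) (NP n.+1 s) ?subr0//.
by rewrite leq_maxl.
Qed.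

End SmallSimplices.

(** * The splitting *)

Section LinearSection.
Context {R : fieldType} {A B : lmodType R} (p : {linear A -> B}).
Hypothesis p_surj : forall y, exists x, p x = y.

(** By Zorn: a maximal subspace meeting the kernel only in 0 surjects, since a preimage [a] of a
    missed [y] could be adjoined. Dividing by the coefficient [r] of [a] uses the field. *)
Lemma exists_kernel_complement : exists D : set A,
  [/\ forall a x y, D x -> D y -> D (a *: x + y),
      forall x, D x -> p x = 0 -> x = 0 & forall y, exists2 x, D x & p x = y].
Proof.
pose P (D : set A) := (forall a x y, D x -> D y -> D (a *: x + y)) /\
  (forall x, D x -> p x = 0 -> x = 0).
have [|D [[DL D0] Dmax]] := @Zorn_bigcup A P.
  move=> F FP Ftot; split; last by move=> x [X /FP[_]]; apply.
  move=> a x y [X FX Xx] [Y FY Yy].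
  have [XY|YX] := Ftot _ _ FX FY.
    by exists Y => //; have [YL _] := FP _ FY; apply: YL => //; exact: XY.
  by exists X => //; have [XL _] := FP _ FX; apply: XL => //; exact: YX.
have max E : P E -> D `<=` E -> E `<=` D.
  by move=> PE DE; apply: contrapT => ED; exact: (Dmax E).
(* [P] holds of the empty set, as the union of the empty chain requires, so [0] lies in [D] only by
   maximality. *)
have D00 : D 0.
  apply: (max [set x | D x \/ x = 0]); [split|by left|by right].
    move=> a x y /= [Dx|->] [Dy|->].
    - by left; exact: DL.
    - by left; rewrite addr0 -[a](subrK 1) scalerDl scale1r; exact: DL.
    - by left; rewrite scaler0 add0r.
    - by right; rewrite scaler0 addr0.
  by move=> x [/D0//|].
exists D; split=> // y; have [a pa] := p_surj y; apply: contrapT => yD.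
pose E := [set x | exists r, exists2 d, D d & x = r *: a + d].
have DE : D `<=` E by move=> d Dd; exists 0; exists d; rewrite // scale0r add0r.
have Ea : E a by exists 1; exists 0; rewrite // scale1r addr0.
suff PE : P E by apply: yD; exists a => //; exact: (max E PE DE).
split.
  move=> b x x' [r [d Dd ->]] [r' [d' Dd' ->]].
  exists (b * r + r'); exists (b *: d + d'); first exact: DL.
  by rewrite scalerDr scalerA addrACA -scalerDl.
move=> x [r [d Dd ->]]; have [->|r0] := eqVneq r 0.
  by rewrite scale0r add0r; exact: D0.
rewrite linearD linearZ pa => yd; exfalso; apply: yD.
exists (- r^-1 *: d + 0); first exact: DL.
rewrite addr0 linearZ; apply: (scalerI r0); rewrite scalerA mulrN mulfV// scaleN1r.
by apply/eqP; rewrite eq_sym -addr_eq0 yd.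
Qed.

End LinearSection.

(* [rel] is the graph of an isomorphism between the kernel of [p] and [C]. *)
Lemma splitting_of_relation (R : fieldType) (A B C : lmodType R) (p : {linear A -> B})
    (rel : A -> C -> Prop) :
  (forall y, exists x, p x = y) ->
  (forall a x y x' y', rel x y -> rel x' y' -> rel (a *: x + x') (a *: y + y')) ->
  (forall x y, rel x y -> p x = 0) -> (forall x, p x = 0 -> exists y, rel x y) ->
  (forall y, exists x, rel x y) ->
  (forall y, rel 0 y -> y = 0) -> (forall x, rel x 0 -> x = 0) ->
  exists phi : {linear A -> (B * C)%type}, bijective phi.
Proof.
move=> p_surj rel_lin rel_p p_rel rel_tot rel0l rel0r.
have [D [DL D0 Dsurj]] := exists_kernel_complement p_surj.
have subl x y x' y' : rel x y -> rel x' y' -> rel (x - x') (y - y').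
  by move=> xy xy'; have := rel_lin (-1) _ _ _ _ xy' xy; rewrite !scaleN1r ![- _ + _]addrC.
have subD x y : D x -> D y -> D (x - y).
  by move=> Dx Dy; have := DL (-1) _ _ Dy Dx; rewrite scaleN1r addrC.
have decomp x : exists dc : A * C, D dc.1 /\ rel (x - dc.1) dc.2.
  have [d Dd pd] := Dsurj (p x); have [|c dc] := p_rel (x - d).
    by rewrite linearB pd subrr.
  by exists (d, c).
(* With this, linearity and surjectivity of [phi] follow by exhibiting any decomposition. *)
have decomp_uniq x d c d' c' : D d -> rel (x - d) c -> D d' -> rel (x - d') c' -> c = c'.
  move=> Dd dc Dd' dc'.
  have dd : d = d'.
    apply/subr0_eq/D0; first exact: subD.
    have := rel_p _ _ dc; have := rel_p _ _ dc'.
    rewrite !linearB => /subr0_eq <- /subr0_eq <-; exact: subrr.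
  apply/subr0_eq/rel0l; move: dc'; rewrite -dd => dc'.
  by have := subl _ _ _ _ dc dc'; rewrite subrr.
pose dec x := projT1 (cid (decomp x)).
have decD x : D (dec x).1 by exact: (projT2 (cid (decomp x))).1.
have decR x : rel (x - (dec x).1) (dec x).2 by exact: (projT2 (cid (decomp x))).2.
pose phi x : (B * C)%type := (p x, (dec x).2).
have phiL : linear phi.
  move=> a x y; congr pair; first exact: linearP.
  apply: (decomp_uniq (a *: x + y) _ _ (a *: (dec x).1 + (dec y).1)) => //.
    exact: DL.
  rewrite opprD addrACA -scalerBr; exact: rel_lin.
pose phiLin := GRing.isLinear.Build R A (B * C)%type _ phi phiL.
pose phi' : {linear A -> (B * C)%type} := HB.pack phi phiLin.
exists phi'.
have inj : injective phi.
  move=> x y [pxy dxy]; apply/subr0_eq.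
  have dd : (dec x).1 = (dec y).1.
    apply/subr0_eq/D0; first exact: subD.
    have := rel_p _ _ (decR x); have := rel_p _ _ (decR y).
    by rewrite !linearB => /subr0_eq <- /subr0_eq <-; rewrite pxy subrr.
  apply: rel0r; have := subl _ _ _ _ (decR x) (decR y).
  by rewrite dxy subrr dd opprB addrA subrK.
have surj (z : B * C) : exists x, phi x = z.
  case: z => b c; have [d Dd pd] := Dsurj b; have [k kc] := rel_tot c.
  exists (k + d); congr pair; first by rewrite linearD (rel_p _ _ kc) add0r.
  by apply: (decomp_uniq (k + d) _ _ d) => //; rewrite addrK.
pose psi z := projT1 (cid (surj z)).
have psiK : cancel psi phi by move=> z; exact: (projT2 (cid (surj z))).
exists psi => //; move=> x; apply: inj; exact: psiK.
Qed.

(** * Restriction to subspaces *)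

Lemma coh_class0 (R : comNzRingType) (C : cochainComplex R) k :
  coh_class (0 : cocycles C k) = 0.
Proof. by apply: (addrI (coh_class 0)); rewrite -coh_classD !addr0. Qed.

Section Subspaces.
Context {K : realType} {R : comNzRingType} {X : topologicalType}.
Local Notation cochain := (singular_cochains K R X).
Implicit Types A B : set X.

Definition inclusion A (x : set_type A) : X := set_val x.

Lemma inclusion_continuous A : continuous (@inclusion A).
Proof. exact: initial_continuous. Qed.
HB.instance Definition _ A :=
  isContinuous.Build (set_type A) X (@inclusion A) (@inclusion_continuous A).

Definition cochain_restr A n : cochain n -> singular_cochains K R (set_type A) n :=
  @singular_comp K R (set_type A) X (@inclusion A : continuousType _ _) n.
Arguments cochain_restr A {n} c.
HB.instance Definition _ A n := GRing.Linear.on (@cochain_restr A n).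

Lemma restrict_codiff A n (c : cochain n) :
  cochain_restr A (singular_codiff c) = singular_codiff (cochain_restr A c).
Proof. exact: (singular_compK (@inclusion A : continuousType _ _)). Qed.

Definition lies_in A n (s : singular_simplex K X n) := forall x, A (s x).

Lemma lies_in_factor A n (s : singular_simplex K X n) : lies_in A s ->
  exists t : singular_simplex K (set_type A) n, (@inclusion A \o t : continuousType _ _) = s.
Proof.
move=> sA; pose t x : set_type A := exist _ (s x) (mem_set (sA x)).
have tc : continuous t.
  apply: continuous_comp_initial.
  by have -> : set_val \o t = s :> (_ -> _) by []; exact: cts_fun.
pose tC := isContinuous.Build _ _ t tc.
exists (HB.pack t tC : continuousType _ _).
exact/continuousEP.
Qed.

Lemma restrict_eqP A n (c c' : cochain n) :
  cochain_restr A c = cochain_restr A c' <-> forall s, lies_in A s -> c s = c' s.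
Proof.
split=> [e s /lies_in_factor[t <-]|e].
  by have := congr1 (fun u => u t) e.
apply/funext => t; apply: e => x; exact: set_mem (svalP (t x)).
Qed.

(** Extension by zero; the factorization picked by [cid] is unique because the inclusion is
    injective. *)
Lemma restrict_surj A n (c : singular_cochains K R (set_type A) n) :
  exists a : cochain n, cochain_restr A a = c.
Proof.
pose a : cochain n := fun s =>
  if pselect (exists t : singular_simplex K (set_type A) n,
    (@inclusion A \o t : continuousType _ _) = s) is left h then c (projT1 (cid h)) else 0.
exists a; apply/funext => t; rewrite /cochain_restr /singular_comp /a.
case: pselect => [h|]; last by case; exists t.
congr c; apply/continuousEP => x; apply: val_inj.
by have /continuousEP/(_ x) := projT2 (cid h).
Qed.

Lemma restrict_sub A B n (c c' : cochain n) : A `<=` B ->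
  cochain_restr B c = cochain_restr B c' -> cochain_restr A c = cochain_restr A c'.
Proof.
move=> AB /restrict_eqP e; apply/restrict_eqP => s sA.
by apply: e => x; apply: AB; exact: sA.
Qed.

(* Classes on subspaces are represented by cochains of the whole space [X], which are
   only required to be closed on [A]. *)
Definition is_class A n (a : cochain n) (x : singular_cohomology K R (set_type A) n) :=
  exists2 z : cocycles (singular_complex K R (set_type A)) n,
    val z = cochain_restr A a & x = coh_class z.

Lemma is_class_surj A n (x : singular_cohomology K R (set_type A) n) :
  exists a, is_class a x.
Proof.
rewrite -[x]coh_class_repr; set z := repr _.
have [a az] := restrict_surj (val z : singular_cochains _ _ _ _).
by exists a; exists z.
Qed.

Lemma is_class_ext A n (a a' : cochain n) x :
  cochain_restr A a = cochain_restr A a' -> is_class a x -> @is_class A n a' x.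
Proof. by move=> aa' [z za ->]; exists z; rewrite // za. Qed.

Lemma is_class_codiff A n (a : cochain n) x :
  @is_class A n a x -> cochain_restr A (singular_codiff a) = 0.
Proof.
move=> [z za _]; rewrite restrict_codiff -za.
by have := cocycle_prop z; rewrite unfold_in => /eqP.
Qed.

Lemma cocycle_is_class A n (a : cochain n) :
  cochain_restr A (singular_codiff a) = 0 -> exists x, @is_class A n a x.
Proof.
move=> a0; have az : cochain_restr A a \in is_cocycle (singular_complex K R (set_type A)) n.
  by rewrite unfold_in /is_cocycle /= -restrict_codiff a0.
by exists (coh_class (Cocycle az)); exists (Cocycle az).
Qed.

Lemma is_classP A n a (x y : singular_cohomology K R (set_type A) n) (r : R) a' :
  is_class a x -> is_class a' y -> is_class (r *: a + a') (r *: x + y).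
Proof.
move=> [z za ->] [z' za' ->]; exists (r *: z + z'); last by rewrite coh_classD coh_classZ.
by rewrite [RHS]linearP /= -za -za'.
Qed.

Lemma is_class0 A n : @is_class A n 0 0.
Proof.
exists 0; first by rewrite linear0.
by rewrite coh_class0.
Qed.

Lemma is_classZ A n (r : R) a (x : singular_cohomology K R (set_type A) n) :
  is_class a x -> is_class (r *: a) (r *: x).
Proof. by move=> ax; have := is_classP r ax (is_class0 A n); rewrite !addr0. Qed.

Lemma is_classB A n a a' (x y : singular_cohomology K R (set_type A) n) :
  is_class a x -> is_class a' y -> is_class (a - a') (x - y).
Proof. by move=> ax ay; have := is_classP (-1) ay ax; rewrite !scaleN1r ![- _ + _]addrC. Qed.

Lemma is_class_sum A n (I : finType) (a : I -> cochain n) x :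
  (forall i, is_class (a i) (x i)) -> @is_class A n (\sum_i a i) (\sum_i x i).
Proof.
move=> ax; elim/big_ind2: _ => //; first exact: is_class0.
by move=> u u' v v' uu' vv'; have := is_classP 1 uu' vv'; rewrite !scale1r.
Qed.

Lemma is_class_image A n a (x : singular_cohomology K R (set_type A) n) :
  is_class a x -> x = 0 <-> in_image (cochain_restr A a : singular_complex K R (set_type A) n).
Proof.
move=> [z <- ->]; have [z0 z00 ->] := is_class0 A n; rewrite linear0 in z00.
by rewrite coh_classP z00 subr0.
Qed.

Lemma is_class_inj A n a (x y : singular_cohomology K R (set_type A) n) :
  is_class a x -> is_class a y -> x = y.
Proof.
move=> ax ay; apply/subr0_eq/(is_class_image (is_classB ax ay)).
by rewrite subrr linear0; exact: in_image0.
Qed.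

(** The benefit of global representatives: a restriction map of the Leray sheaf leaves the
    representing cochain unchanged. *)
Lemma is_class_sub A B n a (x : singular_cohomology K R (set_type B) n) (AB : A `<=` B) :
  is_class a x ->
  is_class a (singular_pullback K R (set_incl AB : continuousType _ _) n x).
Proof.
move=> [z za ->]; rewrite /= coh_mapE; eexists; last by [].
rewrite /= za; apply/funext => s; rewrite /cochain_restr /singular_comp; congr a.
exact/continuousEP.
Qed.

Lemma is_class_cocycle A n (z : cocycles (singular_complex K R X) n) :
  is_class (val z)
    (singular_pullback K R (@inclusion A : continuousType _ _) n (coh_class z)).
Proof. by rewrite /= coh_mapE; eexists; last by []. Qed.

End Subspaces.
Arguments cochain_restr {K R X} A {n} c.

(** * The Mayer-Vietoris argument over a one-dimensional nerve *)

Section NerveGraph.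
Context {R : comNzRingType} {m : nat} {Y : Type} (V : 'I_m -> set Y).
Hypothesis nerve_dim : dim_le (nerve V) 1.
Variable o : {set 'I_m} -> bool.
Local Notation N := (nerve V).
Local Notation vertex0 := (dim_simplex N 0).
Local Notation edge := (dim_simplex N 1).
Local Notation verts s := (val (val s)).

(* The orientations [o] may also reverse vertices, so the augmentation of the Cech complex
   carries a sign. *)
Definition vertex_sign (v : vertex0) : R := (-1) ^+ o (verts v).

Lemma vertex_signK v : vertex_sign v * vertex_sign v = 1.
Proof. by rewrite -expr2 /vertex_sign -exprM mulnC exprM sqrrN !expr1n. Qed.

Lemma mk_simplex (s : {set 'I_m}) k : s \in nerve_simplices V -> #|s| = k.+1 ->
  exists t : dim_simplex N k, verts t = s.
Proof.
move=> sN sk; have sk' : #|s| == k.+1 by rewrite sk.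
by exists (exist (fun u : simplex N => #|val u| == k.+1)
  (exist (fun u => u \in simplices N) s sN) sk').
Qed.

Lemma edge_ends (e : edge) : exists ab : vertex0 * vertex0,
  ab.1 != ab.2 /\ verts e = (verts ab.1 :|: verts ab.2)%SET.
Proof.
have /cards2P[a [b [ab eE]]] := valP e.
have sub v : v \in verts e -> exists t : vertex0, verts t = [set v]%SET.
  move=> ve; apply: mk_simplex; last by rewrite cards1.
  apply: (nerve_face (valP (val e))); first by rewrite finset.sub1set.
  by apply/set0Pn; exists v; rewrite inE.
have [|va vaE] := sub a; first by rewrite eE !inE eqxx.
have [|vb vbE] := sub b; first by rewrite eE !inE eqxx orbT.
exists (va, vb); split; last by rewrite /= vaE vbE eE.
apply: contraNneq ab => /= vab; have : a \in verts vb by rewrite -vab vaE inE.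
by rewrite vbE inE => /eqP->.
Qed.

(** Once the vertex signs are removed, the two incidences differ exactly by [a < b] against [b < a],
    hence are opposite. *)
Lemma incidence_ends (e : edge) (va vb : vertex0) :
  va != vb -> verts e = (verts va :|: verts vb)%SET ->
  [/\ incidence R o (verts va) (verts e) ^+ 2 = 1,
      incidence R o (verts va) (verts e) * vertex_sign va +
      incidence R o (verts vb) (verts e) * vertex_sign vb = 0 &
      forall (M : lmodType R) (g : vertex0 -> M),
        \sum_v incidence R o (verts v) (verts e) *: g v =
        incidence R o (verts va) (verts e) *: g va +
        incidence R o (verts vb) (verts e) *: g vb].
Proof.
have /cards1P[a vaE] := valP va; have /cards1P[b vbE] := valP vb.
move=> anb eE; have ab : a != b.
  by apply: contraNneq anb => ab; apply/eqP/val_inj/val_inj; rewrite /= vaE ab vbE.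
rewrite vaE vbE in eE.
have incE x y : x != y -> incidence R o [set x]%SET (y |: [set x])%SET =
    (-1) ^+ (o [set x]%SET + o (y |: [set x])%SET + (x < y)%N).
  move=> xy; rewrite incidenceU1 ?inE 1?eq_sym//; congr (_ ^+ (_ + _)).
  have [xy'|yx] := ltnP x y.
    rewrite (_ : [set i in _ | _]%SET = [set x]%SET) ?cards1//.
    apply/finset.setP => i; rewrite !inE.
    have [->|_] := eqVneq i y; first by rewrite ltnn eq_sym (negbTE xy).
    by have [->|_] := eqVneq i x.
  apply: eq_card0 => i; rewrite !inE.
  have [->|_] := eqVneq i y; first by rewrite ltnn.
  by have [->|_] := eqVneq i x; rewrite //= ltnNge yx.
have eE' : verts e = (b |: [set a])%SET by rewrite eE finset.setUC.
have iaE : incidence R o (verts va) (verts e) =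
    (-1) ^+ (o [set a]%SET + o (verts e) + (a < b)%N) by rewrite vaE eE' incE.
have ibE : incidence R o (verts vb) (verts e) =
    (-1) ^+ (o [set b]%SET + o (verts e) + (b < a)%N) by rewrite vbE eE incE // eq_sym.
split.
- by rewrite iaE -exprM mulnC exprM sqrrN expr1n expr1n.
- rewrite iaE ibE /vertex_sign vaE vbE -!exprD -![(-1) ^+ (_ + _)]signr_odd !oddD !oddb.
  have : (b < a)%N = ~~ (a < b)%N.
    rewrite -leqNgt ltn_neqAle (_ : (b != a :> nat))//.
    by apply: contraNneq ab => /val_inj->.
  move=> ->; case: (o _) (o _) (o _) (a < b)%N => [] [] [] [];
  by rewrite /= ?expr0 ?expr1 ?addrN ?addNr.
move=> M g; rewrite (bigD1 va)//= (bigD1 vb) 1?eq_sym//=; congr (_ + _).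
rewrite big1 ?addr0// => v /andP[vna vnb].
rewrite [incidence _ _ _ _](_ : _ = 0) ?scale0r//; apply/eqP; apply: contraT.
rewrite /incidence; case: ifP => [/andP[ve _] _|]; last by rewrite eqxx.
have /cards1P[x vx] := valP v.
have : x \in verts e by rewrite (fintype.subsetP ve)// vx inE.
rewrite eE !inE => /orP[]/eqP xE.
  by case/eqP: vna; apply: val_inj; apply: val_inj; rewrite /= vx xE vaE.
by case/eqP: vnb; apply: val_inj; apply: val_inj; rewrite /= vx xE vbE.
Qed.

Lemma nerve_union (s t : {set 'I_m}) y : nerve_support V s y -> nerve_support V t y ->
  nerve_support V (s :|: t) y.
Proof. by move=> sy ty i /=; rewrite inE => /orP[]; [exact: sy|exact: ty]. Qed.

(** The union of the two edges has [y] in its support, so it is a simplex with at most two vertices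
    and equals each of them. *)
Lemma edge_unique (e e' : edge) y :
  nerve_support V (verts e) y -> nerve_support V (verts e') y -> e = e'.
Proof.
move=> ey ey'; have ee' := nerve_union ey ey'.
have eN : (verts e :|: verts e')%SET \in simplices N.
  rewrite inE; apply/andP; split; last by apply/asboolP; exists y.
  apply/set0Pn; have /set0Pn[i ie] := simplices_neq0 (valP (val e)).
  by exists i; rewrite inE ie.
have c2 := nerve_dim eN.
have E (a : edge) : verts a \subset (verts e :|: verts e')%SET ->
    verts a = (verts e :|: verts e')%SET.
  by move=> sub; apply/eqP; rewrite eqEcard sub (eqP (valP a)).
apply: val_inj; apply: val_inj => /=.
by rewrite (E e) ?finset.subsetUl// [RHS]E// finset.subsetUr.
Qed.

Lemma edge_of_vertices (v v' : vertex0) y : v != v' ->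
  nerve_support V (verts v) y -> nerve_support V (verts v') y ->
  exists e : edge, verts e = (verts v :|: verts v')%SET.
Proof.
move=> vv' vy vy'; apply: mk_simplex.
  rewrite inE; apply/andP; split.
    apply/set0Pn; have /set0Pn[i ie] := simplices_neq0 (valP (val v)).
    by exists i; rewrite inE ie.
  by apply/asboolP; exists y; exact: nerve_union.
have /cards1P[a aE] := valP v; have /cards1P[b bE] := valP v'.
rewrite aE bE cards2; case: eqVneq => //= ab; case/eqP: vv'.
by apply: val_inj; apply: val_inj; rewrite /= aE ab bE.
Qed.

Lemma vertex_of_cover i y : V i y -> exists v : vertex0, verts v = [set i]%SET.
Proof.
move=> Viy; apply: mk_simplex; last by rewrite cards1.
rewrite inE; apply/andP; split; first by apply/set0Pn; exists i; rewrite inE.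
by apply/asboolP; exists y => j /=; rewrite inE => /eqP->.
Qed.

End NerveGraph.

(** * Exactness of the cochain sequence, then the edge homomorphism and its kernel *)

Section LeraySequence.
Context {K : realType} {R : fieldType} {X Y : topologicalType} (f : X -> Y).
Hypothesis f_cont : continuous f.
Context {m : nat} (V : 'I_m -> set Y).
Hypotheses (V_open : forall i, open (V i)) (V_cover : range f `<=` \bigcup_i V i).
Hypothesis nerve_dim : dim_le (nerve V) 1.
Variable o : {set 'I_m} -> bool.
Local Notation N := (nerve V).
Local Notation vertex0 := (dim_simplex N 0).
Local Notation edge := (dim_simplex N 1).
Local Notation cochain := (singular_cochains K R X).
Local Notation complex := (singular_complex K R X).
Local Notation U s := (f @^-1` nerve_support V (val (val s))).
Local Notation inc v e := (incidence R o (val (val v)) (val (val e))).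
Local Notation sign v := (@vertex_sign R m Y V o v).
Local Notation leray n := (leray_sheaf K R f V n).
Local Notation vanishing := (@vanishes_on_small K R X _ (fun i => f @^-1` V i)).

(** Its image witnesses that the supports containing a given singular simplex are nonempty. *)
Definition simplex_point n : std_simplex K n := vertex ord0.

Lemma small_lies_in_vertex n (s : singular_simplex K X n) :
  small (fun i => f @^-1` V i) s -> exists v : vertex0, lies_in (U v) s.
Proof.
move=> [i sV]; have [v vE] := vertex_of_cover (sV (simplex_point n)).
by exists v => x j /=; rewrite vE inE => /eqP->; exact: sV.
Qed.

Lemma lies_in_small n (v : vertex0) (s : singular_simplex K X n) :
  lies_in (U v) s -> small (fun i => f @^-1` V i) s.
Proof.
have /cards1P[i vE] := valP v.
by move=> sv; exists i => x; apply: (sv x); rewrite /= vE inE.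
Qed.

Lemma vanishing_restrict n (c : cochain n) :
  vanishing c <-> forall v : vertex0, cochain_restr (U v) c = 0.
Proof.
split=> [c0 v|c0 s /small_lies_in_vertex[v sv]].
  rewrite -(linear0 (cochain_restr (U v))); apply/restrict_eqP => s sv.
  by rewrite c0//; exact: lies_in_small sv.
have /restrict_eqP : cochain_restr (U v) c = cochain_restr (U v) 0 by rewrite c0 linear0.
exact.
Qed.

Lemma acyclic n (c : cochain n.+1) : singular_codiff c = 0 ->
  (forall v : vertex0, cochain_restr (U v) c = 0) ->
  exists2 b : cochain n, singular_codiff b = c & forall v : vertex0, cochain_restr (U v) b = 0.
Proof.
move=> c0 /vanishing_restrict cv.
have [||b bc /vanishing_restrict b0] := vanishing_cochains_acyclic _ _ c0 cv; last by exists b.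
  by move=> i; apply: open_comp => // x _; exact: f_cont.
move=> x; have [|i _ ix] := @V_cover (f x); first by exists x.
by exists i.
Qed.

(* The Cech differential, on families of cochains of the whole space. *)
Definition total n (a : vertex0 -> cochain n) (e : edge) : cochain n :=
  \sum_v inc v e *: a v.

Lemma total_linear n r (a a' : vertex0 -> cochain n) e :
  total (fun v => r *: a v + a' v) e = r *: total a e + total a' e.
Proof.
rewrite /total scaler_sumr -big_split; apply: eq_bigr => v _ /=.
by rewrite scalerDr !scalerA mulrC.
Qed.

Lemma totalB n (a a' : vertex0 -> cochain n) e :
  total (fun v => a v - a' v) e = total a e - total a' e.
Proof. by rewrite /total -sumrB; apply: eq_bigr => v _; rewrite scalerBr. Qed.

Lemma total_codiff n (a : vertex0 -> cochain n) e :
  total (fun v => singular_codiff (a v)) e = singular_codiff (total a e).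
Proof.
by rewrite /total [RHS]raddf_sum; apply: eq_bigr => v _; rewrite [RHS]linearZ.
Qed.

(** The Cech differential kills the signed augmentation: the two ends of [e] contribute [c] with
    opposite signs. *)
Lemma total_sign n (c : cochain n) e : total (fun v => sign v *: c) e = 0.
Proof.
have [[a b] [/= anb eE]] := edge_ends e.
have [_ ab E] := incidence_ends (R := R) o anb eE.
by rewrite /total E !scalerA -scalerDl ab scale0r.
Qed.

Lemma inc_sub (v : vertex0) (e : edge) : inc v e != 0 -> val (val v) \subset val (val e).
Proof. by move/incidence_neq0 => [x _ ->]; exact: finset.subsetUr. Qed.

Lemma restrict_total n (a a' : vertex0 -> cochain n) e :
  (forall v, cochain_restr (U v) (a v) = cochain_restr (U v) (a' v)) ->
  cochain_restr (U e) (total a e) = cochain_restr (U e) (total a' e).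
Proof.
move=> aa'; rewrite /total !raddf_sum; apply: eq_bigr => v _.
rewrite /= !linearZ /=; have [->|/inc_sub ve] := eqVneq (inc v e) 0; first by rewrite !scale0r.
by congr (_ *: _); apply: restrict_sub (aa' v); exact: leray_sub.
Qed.

Lemma total_surj n (g : edge -> cochain n) :
  exists h : vertex0 -> cochain n,
    forall e, cochain_restr (U e) (total h e) = cochain_restr (U e) (g e).
Proof.
have /choice[ends endsP] := @edge_ends m Y V.
(* A simplex lies over at most one edge; put all of [g] on the first end of that edge. *)
pose h (v : vertex0) : cochain n := fun s =>
  \sum_(e : edge | ((ends e).1 == v) && `[< lies_in (U e) s >]) inc v e * g e s.
exists h => e; apply/restrict_eqP => s se.
have [ab eE] := endsP e; have [ae2 _ E] := incidence_ends (R := R) o ab eE.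
have uniq e' : lies_in (U e') s -> e' = e.
  move=> se'; exact: (edge_unique nerve_dim (se' (simplex_point n)) (se (simplex_point n))).
transitivity (inc (ends e).1 e * h (ends e).1 s + inc (ends e).2 e * h (ends e).2 s).
  by rewrite /total E.
rewrite [X in _ + _ * X]/h big_pred0 ?mulr0 ?addr0; last first.
  move=> e'; apply/negP => /andP[/eqP e'2 /asboolP /uniq e'e].
  by move: ab; rewrite -e'2 e'e eqxx.
(* The factor [inc v e] in [h] is its own inverse, so [g e s] comes back. *)
rewrite /h (big_pred1 e); first by rewrite mulrA -expr2 ae2 mul1r.
move=> e'; apply/andP/eqP => [[_ /asboolP /uniq//]|->].
by split=> //; apply/asboolP.
Qed.

(** Exactness in the middle: a simplex in both [U v] and [U w] lies over the edge they span, where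
    [total a] vanishes, so the signed values agree and the chosen vertex is immaterial. *)
Lemma total_patch n (a : vertex0 -> cochain n) :
  (forall e, cochain_restr (U e) (total a e) = 0) ->
  exists z : cochain n, forall v, cochain_restr (U v) z = cochain_restr (U v) (sign v *: a v).
Proof.
move=> a0.
pose z : cochain n := fun s =>
  if pselect (exists v : vertex0, lies_in (U v) s) is left h
  then sign (projT1 (cid h)) * a (projT1 (cid h)) s else 0.
exists z => v; apply/restrict_eqP => s sv; rewrite /z.
case: pselect => [h|]; last by case; exists v.
have := projT2 (cid h); move: (projT1 _) => w sw.
have [->//|vw] := eqVneq v w.
have [e eE] := edge_of_vertices vw (sv (simplex_point n)) (sw (simplex_point n)).
have se : lies_in (U e) s.
  by move=> x; rewrite /= eE; apply: nerve_union; [exact: sv|exact: sw].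
have := a0 e; rewrite -(linear0 (cochain_restr (U e))) => /restrict_eqP/(_ s se).
have [ve2 vwe E] := incidence_ends (R := R) o vw eE.
rewrite /total E => vwa.
have {}vwa : inc v e * a v s + inc w e * a w s = 0 by [].
transitivity (sign v * a v s); last by [].
move: ve2 vwe vwa (vertex_signK (R := R) o v) (vertex_signK (R := R) o w).
move: (inc v e) (inc w e) (sign v) (sign w) (a v s : R) (a w s : R) => i j p q x y.
move=> i2 ij xy p2 q2.
(* As all four signs square to 1, [i p + j q = 0] determines [j], and then [i x + j y = 0] gives
   [p x = q y]. *)
have jE : j = - (i * p * q).
  by rewrite -[j]mulr1 -q2 mulrA (_ : j * q = - (i * p)) ?mulNr//;
  apply/eqP; rewrite -addr_eq0 addrC ij.
have xE : x = p * q * y.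
  rewrite -[x]mul1r -i2 -[p * q * y]mul1r -[in RHS]i2; apply: subr0_eq.
  rewrite -[RHS](mulr0 i) -xy jE; ring.
by rewrite xE !mulrA p2 mul1r.
Qed.

Local Notation class_at v := (@is_class K R X (U v) _).

(** The coboundary of the patched cochain vanishes on each [U v], so [acyclic] provides a correction
    that leaves the restrictions to the [U v] unchanged. *)
Lemma extend_to_cocycle n (a : vertex0 -> cochain n) :
  (forall v, cochain_restr (U v) (singular_codiff (a v)) = 0) ->
  (forall e, cochain_restr (U e) (total a e) = 0) ->
  exists z : cocycles complex n,
    forall v, cochain_restr (U v) (val z) = cochain_restr (U v) (sign v *: a v).
Proof.
move=> aK /total_patch[z zv].
have [||b bz bv] := @acyclic n (singular_codiff z).
- exact: singular_codiffK.
- move=> v; rewrite restrict_codiff zv -restrict_codiff.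
  rewrite (_ : singular_codiff (sign v *: a v) = sign v *: singular_codiff (a v));
    last exact: linearZ.
  by rewrite linearZ /= aK scaler0.
have zb : (z - b : complex n) \in is_cocycle complex n.
  by rewrite unfold_in /is_cocycle /= raddfB /= bz subrr.
exists (Cocycle zb) => v; rewrite -zv /= -[RHS]subr0 -(bv v).
exact: raddfB.
Qed.

Lemma is_class_codiff_sheaf n (a : vertex0 -> cochain n) (c : sheaf_cochains (leray n) 0) e :
  (forall v, class_at v (a v) (c v)) -> class_at e (total a e) (sheaf_codiff o c e).
Proof.
move=> ac; apply: is_class_sum => v.
have [->|/inc_sub ve] := eqVneq (inc v e) 0; first by rewrite !scale0r; exact: is_class0.
by rewrite (restr0E _ ve); apply: is_classZ; exact: is_class_sub.
Qed.

Lemma is_class_family n k (c : sheaf_cochains (leray n) k) :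
  exists a : dim_simplex N k -> cochain n, forall s, class_at s (a s) (c s).
Proof.
have /choice[a aP] : forall s : dim_simplex N k, exists b : cochain n, class_at s b (c s).
  by move=> s; exact: is_class_surj.
by exists a.
Qed.

Definition cobounding n (c : cochain n) : Prop :=
  match n return cochain n -> Prop with
  | 0 => fun c => c = 0
  | j.+1 => fun c => exists b, c = singular_codiff b
  end c.

Lemma image_restr (A : set X) n (c : cochain n) :
  in_image (cochain_restr A c : singular_complex K R (set_type A) n) <->
  exists2 b, cobounding b & cochain_restr A c = cochain_restr A b.
Proof.
case: n c => [|n] c /=; split.
- by exists 0; rewrite ?linear0.
- by move=> [b ->]; rewrite linear0.
- move=> [b ->]; have [b' <-] := restrict_surj b.
  by exists (singular_codiff b'); [exists b'|rewrite restrict_codiff].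
- by move=> [_ [b ->] ->]; exists (cochain_restr A b); rewrite restrict_codiff.
Qed.

Lemma cobounding_codiff n (c : cochain n) : cobounding c -> singular_codiff c = 0.
Proof.
case: n c => [|n] c /= => [->|[b ->]]; last exact: singular_codiffK.
exact: (linear0 (@singular_codiff K R X 0)).
Qed.

Lemma cobounding_class (v : vertex0) n (c : cochain n) : cobounding c -> class_at v c 0.
Proof.
move=> cb; have [|x cx] := @cocycle_is_class K R X (U v) n c.
  by rewrite cobounding_codiff// linear0.
have x0 : x = 0 by apply/(is_class_image cx)/image_restr; exists c.
by rewrite x0 in cx.
Qed.

(** Lifting primitives of the [total a e] through [total_surj] makes the cochains, not just their
    classes, agree over the edges. In degree 0 there are no primitives and [h] is 0. *)
Lemma correct_total n (a : vertex0 -> cochain n) :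
  (forall e, class_at e (total a e) 0) ->
  exists2 h : vertex0 -> cochain n, forall v, cobounding (h v) &
    forall e, cochain_restr (U e) (total (fun v => a v - h v) e) = 0.
Proof.
move=> a0; have {a0} /choice[g gP] : forall e : edge, exists b, cobounding b /\
    cochain_restr (U e) (total a e) = cochain_restr (U e) b.
  by move=> e; have [b] := (image_restr _ _).1 ((is_class_image (a0 e)).1 erefl); exists b.
have [h hb hg] : exists2 h : vertex0 -> cochain n, forall v, cobounding (h v) &
    forall e, cochain_restr (U e) (total h e) = cochain_restr (U e) (g e).
  case: n a g gP => [|n] a g gP /=.
    exists (fun=> 0) => // e; have [/= -> _] := gP e.
    by rewrite /total; under eq_bigr do rewrite scaler0; rewrite big1.
  have /choice[k kP] : forall e : edge, exists b, g e = singular_codiff b.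
    by move=> e; have [[b ->]] := gP e; exists b.
  have [h hk] := total_surj k.
  exists (fun v => singular_codiff (h v)) => [v|e]; first by exists (h v).
  by rewrite total_codiff restrict_codiff hk kP restrict_codiff.
exists h => // e; rewrite totalB [LHS]raddfB /= hg; have [_ ->] := gP e.
exact: subrr.
Qed.

(* The edge homomorphism [H^n(X) -> H^0(N; L^n)], by restriction to the vertices. *)
Definition leray_edge_cochain n (x : singular_cohomology K R X n) :
    sheaf_cochains (leray n) 0 :=
  fun v => sign v *: singular_pullback K R (@inclusion X (U v) : continuousType _ _) n x.

Lemma leray_edge_class n (z : cocycles complex n) v :
  class_at v (sign v *: (val z : cochain n)) (leray_edge_cochain (coh_class z) v).
Proof. by apply: is_classZ; exact: is_class_cocycle. Qed.

Lemma leray_edge_cocycle n (x : singular_cohomology K R X n) :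
  leray_edge_cochain x \in is_cocycle (sheaf_complex o (leray n)) 0.
Proof.
rewrite unfold_in /is_cocycle /=; apply/eqP; apply: functional_extensionality_dep => e.
rewrite -[x]coh_class_repr; apply: (@is_class_inj _ _ _ _ _ 0); last exact: is_class0.
rewrite -[X in is_class X _](total_sign (val (repr (x : Quotient.quot _)) : cochain n) e).
by apply: is_class_codiff_sheaf => v; exact: leray_edge_class.
Qed.

Definition leray_edge n (x : singular_cohomology K R X n) :
    sheaf_cohomology o (leray n) 0 :=
  coh_class (Cocycle (leray_edge_cocycle x)).

Lemma leray_edge_linear n : linear (@leray_edge n).
Proof.
move=> a x y; rewrite /leray_edge -coh_classZ -coh_classD; congr coh_class.
apply: val_inj; apply: functional_extensionality_dep => v /=.
transitivity (a *: leray_edge_cochain x v + leray_edge_cochain y v); last by [].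
by rewrite /leray_edge_cochain linearP scalerDr !scalerA mulrC.
Qed.
HB.instance Definition _ n := GRing.isLinear.Build R (singular_cohomology K R X n)
  (sheaf_cohomology o (leray n) 0) _ (@leray_edge n) (@leray_edge_linear n).

(** Representatives of the section are corrected to agree over the edges, then glued to a cocycle.
    Gluing introduces [sign v] and the edge homomorphism does so again, and the two cancel. *)
Lemma leray_edge_surj n y : exists x, @leray_edge n x = y.
Proof.
rewrite -[y]coh_class_repr; move: (repr _) => c.
have [a ac] := is_class_family (val c : sheaf_cochains _ _).
have c0 : sheaf_codiff o (val c : sheaf_cochains (leray n) 0) = 0.
  by have := cocycle_prop c; rewrite unfold_in => /eqP.
have [e|h hb h0] := correct_total (a := a).
  have := is_class_codiff_sheaf e ac; rewrite c0; exact.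
have ahc v : class_at v (a v - h v) ((val c : sheaf_cochains (leray n) 0) v).
  by rewrite -[X in is_class _ X]subr0; apply: is_classB => //; exact: cobounding_class.
have [v|z zP] := extend_to_cocycle _ h0; first exact: is_class_codiff (ahc v).
exists (coh_class z); congr coh_class; apply: val_inj => /=.
apply: functional_extensionality_dep => v.
apply: is_class_inj (leray_edge_class z v) (is_class_ext _ (ahc v)).
by rewrite [RHS]linearZ /= zP [in RHS]linearZ /= scalerA vertex_signK scale1r.
Qed.

Lemma leray_edge_eq0 n (z : cocycles complex n) : leray_edge (coh_class z) = 0 <->
  exists2 b : vertex0 -> cochain n, forall v, cobounding (b v) &
    forall v, cochain_restr (U v) (sign v *: (val z : cochain n)) = cochain_restr (U v) (b v).
Proof.
rewrite -(coh_class0 (sheaf_complex o (leray n)) 0) coh_classP subr0 /=; split.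
  move=> z0; have /choice[b bP] : forall v : vertex0, exists b : cochain n, cobounding b /\
      cochain_restr (U v) (sign v *: (val z : cochain n)) = cochain_restr (U v) b.
    move=> v; have [|b] := (image_restr _ _).1 ((is_class_image (leray_edge_class z v)).1 _).
      by rewrite z0.
    by exists b.
  by exists b => v; have [] := bP v.
move=> [b bb bz]; apply: functional_extensionality_dep => v.
apply/(is_class_image (leray_edge_class z v))/image_restr.
exists (b v) => //; exact: bz.
Qed.

(* The graph of the connecting map: the class [y] of a family of edge cocycles is sent to
   the class [x] of the cocycle obtained by gluing the coboundaries of vertex cochains
   whose differences over the edges are the given cocycles. *)
Definition leray_rel n (x : singular_cohomology K R X n.+1)
    (y : sheaf_cohomology o (leray n) 1) : Prop :=
  exists (z : cocycles complex n.+1) (a : vertex0 -> cochain n)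
    (w : cocycles (sheaf_complex o (leray n)) 1),
  [/\ x = coh_class z, y = coh_class w,
    forall v, cochain_restr (U v) (singular_codiff (a v)) =
      cochain_restr (U v) (sign v *: (val z : cochain n.+1)) &
    forall e, class_at e (total a e) ((val w : sheaf_cochains (leray n) 1) e)].

Lemma leray_rel_linear n a x y x' y' : @leray_rel n x y -> leray_rel x' y' ->
  leray_rel (a *: x + x') (a *: y + y').
Proof.
move=> [z [b [w [-> -> bz bw]]]] [z' [b' [w' [-> -> bz' bw']]]].
exists (a *: z + z'), (fun v => a *: b v + b' v), (a *: w + w').
split; [by rewrite coh_classD coh_classZ|by rewrite coh_classD coh_classZ|move=> v|move=> e].
  transitivity (a *: cochain_restr (U v) (singular_codiff (b v)) +
    cochain_restr (U v) (singular_codiff (b' v))).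
    by rewrite linearP /= linearP.
  rewrite bz bz' -[LHS]linearP /=; congr (cochain_restr (U v) _).
  by rewrite scalerDr !scalerA mulrC.
rewrite total_linear.
rewrite (_ : _ e = a *: (val w : sheaf_cochains (leray n) 1) e +
  (val w' : sheaf_cochains (leray n) 1) e); last by [].
exact: is_classP (bw e) (bw' e).
Qed.

Lemma leray_rel_edge n x y : @leray_rel n x y -> leray_edge x = 0.
Proof.
move=> [z [a [w [-> _ az _]]]]; apply/leray_edge_eq0.
by exists (fun v => singular_codiff (a v)) => v; [exists (a v)|rewrite az].
Qed.

(** There are no 2-simplices, so the target of the coboundary is an empty product. *)
Lemma sheaf_cocycle1 n (c : sheaf_cochains (leray n) 1) :
  c \in is_cocycle (sheaf_complex o (leray n)) 1.
Proof.
rewrite unfold_in /is_cocycle /=; apply/eqP; apply: functional_extensionality_dep => t.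
by have := nerve_dim (valP (val t)); rewrite (eqP (valP t)).
Qed.

(** On [U e] the coboundary of [total a e] is the Cech differential of the signed global cochain
    [z], hence 0, so [total a e] has a class. *)
Lemma leray_rel_exists n (z : cocycles complex n.+1) (a : vertex0 -> cochain n) :
  (forall v, cochain_restr (U v) (singular_codiff (a v)) =
    cochain_restr (U v) (sign v *: (val z : cochain n.+1))) ->
  exists y, leray_rel (coh_class z) y.
Proof.
move=> az.
have ex e : exists y, class_at e (total a e) y.
  apply: cocycle_is_class; rewrite -total_codiff.
  rewrite (restrict_total (a' := fun v => sign v *: (val z : cochain n.+1)))//.
  by rewrite total_sign linear0.
pose c : sheaf_cochains (leray n) 1 := fun e => projT1 (cid (ex e)).
exists (coh_class (Cocycle (sheaf_cocycle1 c))), z, a, (Cocycle (sheaf_cocycle1 c)).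
by split=> // e; exact: (projT2 (cid (ex e))).
Qed.

Lemma edge_leray_rel n x : @leray_edge n.+1 x = 0 -> exists y, leray_rel x y.
Proof.
rewrite -[x]coh_class_repr => /leray_edge_eq0[b bb bz].
have /choice[a aP] : forall v : vertex0, exists a, b v = singular_codiff a by [].
by apply: (@leray_rel_exists _ _ a) => v; rewrite -aP bz.
Qed.

(** Snake construction: edge representatives lift to vertex cochains [a], whose coboundaries agree
    over the edges because the representatives are closed, and therefore glue. *)
Lemma leray_rel_total n y : exists x, @leray_rel n x y.
Proof.
rewrite -[y]coh_class_repr; move: (repr _) => w.
have [g gw] := is_class_family (val w : sheaf_cochains _ _).
have [a ag] := total_surj g.
have [v|e|z zP] := extend_to_cocycle (a := fun v => singular_codiff (a v)).
- by rewrite singular_codiffK linear0.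
- by rewrite total_codiff restrict_codiff ag -restrict_codiff; exact: is_class_codiff (gw e).
exists (coh_class z), z, a, w; split=> // [v|e].
  by rewrite [RHS]linearZ /= zP [in RHS]linearZ /= scalerA vertex_signK scale1r.
exact: is_class_ext (gw e).
Qed.

(** If [z] is the coboundary of [b], subtracting the signed [b] makes each [a v] closed on [U v]
    without changing [total a]; the resulting vertex classes have coboundary [w]. *)
Lemma leray_rel0l n y : @leray_rel n 0 y -> y = 0.
Proof.
move=> [z [a [w [z0 -> az aw]]]].
have [b bz] : exists b : cochain n, val z = singular_codiff b.
  move: z0; rewrite -(coh_class0 complex n.+1) => /esym/coh_classP.
  by rewrite subr0.
have ex : forall v : vertex0, exists c, class_at v (a v - sign v *: b) c.
  move=> v; apply: cocycle_is_class.
  rewrite [singular_codiff _](_ : _ = singular_codiff (a v) - sign v *: singular_codiff b).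
    by rewrite raddfB /= az -bz subrr.
  by rewrite raddfB /= linearZ.
pose c : sheaf_cochains (leray n) 0 := fun v => projT1 (cid (ex v)).
have cP v : class_at v (a v - sign v *: b) (c v) by exact: (projT2 (cid (ex v))).
rewrite -(coh_class0 (sheaf_complex o (leray n)) 1); apply/coh_classP.
rewrite subr0; exists c; apply: functional_extensionality_dep => e.
apply: is_class_inj (aw e) (is_class_ext _ (is_class_codiff_sheaf e cP)).
by rewrite totalB total_sign subr0.
Qed.

(** Write [w] as the coboundary of [c]. Subtracting from [a] representatives of [c] and the [h] of
    [correct_total] keeps the coboundaries on each [U v] and lets the family glue to some [y];
    [acyclic] then applies to [z] minus the coboundary of [y]. *)
Lemma leray_rel0r n x : @leray_rel n x 0 -> x = 0.
Proof.
move=> [z [a [w [-> w0 az aw]]]].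
have [c wc] : exists c, val w = sheaf_codiff o (c : sheaf_cochains (leray n) 0).
  move: w0; rewrite -(coh_class0 (sheaf_complex o (leray n)) 1) => /esym/coh_classP.
  by rewrite subr0.
have [a' ac] := is_class_family c.
have [e|h hb h0] := correct_total (a := fun v => a v - a' v).
  have := is_classB (aw e) (is_class_codiff_sheaf e ac).
  by rewrite -wc subrr -totalB.
have [y yP] := total_patch h0.
pose z' : cochain n.+1 := val z.
have zK : singular_codiff z' = 0.
  by have := cocycle_prop z; rewrite unfold_in => /eqP.
have [||b bz _] := @acyclic n (z' - singular_codiff y).
- by rewrite raddfB /= zK singular_codiffK subrr.
- move=> v; rewrite raddfB /= restrict_codiff yP -restrict_codiff.
  have -> : singular_codiff (sign v *: (a v - a' v - h v)) =
      sign v *: (singular_codiff (a v) - singular_codiff (a' v)).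
    have codB := raddfB (@singular_codiff K R X n).
    rewrite [LHS]linearZ /= [singular_codiff (_ - h v)]codB /=.
    rewrite [singular_codiff (a v - _)]codB /=.
    by rewrite [singular_codiff (h v)](cobounding_codiff (hb v)) subr0.
  have -> : cochain_restr (U v) (sign v *: (singular_codiff (a v) - singular_codiff (a' v))) =
      sign v *: cochain_restr (U v) (singular_codiff (a v)).
    rewrite [LHS]linearZ; congr (_ *: _); rewrite [LHS]raddfB.
    by rewrite [X in _ - X](is_class_codiff (ac v)) subr0.
  rewrite az [X in _ *: X]linearZ scalerA vertex_signK scale1r.
  exact: subrr.
rewrite -(coh_class0 complex n.+1); apply/coh_classP; rewrite subr0.
exists (y + b : cochain n); rewrite -[LHS]/z' -[LHS](subrK (singular_codiff y)) -bz addrC.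
by apply/esym; exact: (raddfD (@singular_codiff K R X n)).
Qed.

Lemma simplex0_eq (x y : std_simplex K 0) : x = y.
Proof.
apply: val_inj; apply/rowP => i; rewrite (ord1 i).
by have := simplex_sum1 x; have := simplex_sum1 y; rewrite !big_ord1 => -> ->.
Qed.

(** The image of a 0-simplex is a point, so every 0-simplex is small and a vanishing 0-cochain is
    0. *)
Lemma leray_edge0_inj x : @leray_edge 0 x = 0 -> x = 0.
Proof.
rewrite -[x]coh_class_repr; move: (repr _) => z /leray_edge_eq0[b b0 bz].
rewrite -(coh_class0 complex 0); apply/coh_classP; rewrite subr0 /=.
pose z' : cochain 0 := val z; rewrite -[LHS]/z'.
have z0 : vanishing z'.
  apply/vanishing_restrict => v; have := bz v; rewrite (b0 v) linear0 linearZ /= -/z'.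
  move=> /(congr1 (fun c => sign v *: c)).
  by rewrite scalerA vertex_signK scale1r scaler0.
apply/funext => s; apply: z0.
have [|i _ ix] := @V_cover (f (s (simplex_point 0))); first by exists (s (simplex_point 0)).
by exists i => p; rewrite (simplex0_eq p (simplex_point 0)).
Qed.

Lemma zero_sheaf_cohomology1 (y : sheaf_cohomology o (zero_sheaf N R) 1) : y = 0.
Proof.
rewrite -[y]coh_class_repr -(coh_class0 _ 1); apply/coh_classP; rewrite subr0.
exists (fun=> 0); apply: functional_extensionality_dep => e.
exact: (etrans (thinmx0 _) (esym (thinmx0 _))).
Qed.

Lemma leray_decomposition n : exists phi : {linear singular_cohomology K R X n ->
    (sheaf_cohomology o (leray n) 0 *
     sheaf_cohomology o (leray_sheaf_pred K R f V n) 1)%type}, bijective phi.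
Proof.
case: n => [|n]; last first.
  apply: (splitting_of_relation (p := @leray_edge n.+1) (rel := @leray_rel n)).
  - exact: leray_edge_surj.
  - exact: leray_rel_linear.
  - exact: leray_rel_edge.
  - exact: edge_leray_rel.
  - exact: leray_rel_total.
  - exact: leray_rel0l.
  - exact: leray_rel0r.
(* Here the edge homomorphism is injective and [H^1] of the zero sheaf is 0, so [x = 0] is the graph
   of the isomorphism between zero modules. *)
apply: (splitting_of_relation (p := @leray_edge 0) (rel := fun x _ => x = 0)).
- exact: leray_edge_surj.
- by move=> a x y x' y' -> ->; rewrite scaler0 addr0.
- by move=> x _ ->; rewrite linear0.
- by move=> x /leray_edge0_inj ->; exists 0.
- by move=> y; exists 0.
- by move=> y _; exact: zero_sheaf_cohomology1.
- by [].
Qed.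

End LeraySequence.

Theorem theorem5p7 (K : realType) (R : fieldType) (X Y : topologicalType)
    (X_compact : compact [set: X]) (X_hausdorff : hausdorff_space X)
    (X_lc : locally_contractible K X)
    (Y_compact : compact [set: Y]) (Y_hausdorff : hausdorff_space Y)
    (Y_lc : locally_contractible K Y)
    (f : X -> Y) (f_cont : continuous f)
    (m : nat) (V : 'I_m -> set Y) (V_inj : injective V)
    (V_open : forall i, open (V i))
    (V_cover : range f `<=` \bigcup_i V i)
    (nerve_dim : dim_le (nerve V) 1)
    (o : {set 'I_m} -> bool) (n : nat) :
  exists phi : {linear singular_cohomology K R X n ->
      (sheaf_cohomology o (leray_sheaf K R f V n) 0 *
       sheaf_cohomology o (leray_sheaf_pred K R f V n) 1)%type},
    bijective phi.
Proof.
exact: leray_decomposition.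
Qed.
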